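(* Let $n\ge1$ and let $\mathcal S\mathrm t_n$ be the $n$th stochastihedron. For each $M\in\operatorname{CM}_n(p,q)$, the space $F(M)$ is a closed cell of dimension $2n-(p+q)$, and $F'(M)$ is homeomorphic to the sphere $S^{2n-(p+q)-1}$ (with $S^{-1}=\varnothing$). Therefore $\mathcal S\mathrm t_n$ has a regular cell decomposition into the cells $F^\circ(M)$, $M\in\operatorname{CM}_n$, and $(\operatorname{CM}_n,\le)$ is the poset of these cells with order given by inclusion of the closures.
   Context: A contingency matrix of size $p\times q$ is an array $M=(m_{ij})_{1\le i\le p,\,1\le j\le q}$ of non-negative integers such that each row and each column contains at least one nonzero entry; its weight is $\sum_{i,j}m_{ij}$. $\operatorname{CM}_n(p,q)$ is the set of contingency matrices of size $p\times q$ and weight $n$, and $\operatorname{CM}_n=\bigcup_{p,q}\operatorname{CM}_n(p,q)$. The contractions are the horizontal ones $\partial'_i:\operatorname{CM}_n(p,q)\to\operatorname{CM}_n(p-1,q)$, $0\le i\le p-2$, replacing the two adjacent slices with first index $i+1$ and $i+2$ by their sum, and the vertical ones $\partial''_j:\operatorname{CM}_n(p,q)\to\operatorname{CM}_n(p,q-1)$, $0\le j\le q-2$, replacing the two adjacent slices with second index $j+1$ and $j+2$ by their sum. Partial order on $\operatorname{CM}_n$: $M\le N$ if $N$ can be obtained from $M$ by a (possibly empty) series of contractions of both kinds (so the $1\times1$ matrix $(n)$ is the maximal element). For a poset $T$, $\operatorname N(T)$ denotes the geometric realization of the nerve (simplicial set of chains $t_0\le\dots\le t_r$) of $T$. The stochastihedron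 is $\mathcal S\mathrm t_n=\operatorname N(\operatorname{CM}_n)$. For $M\in\operatorname{CM}_n$, put $F'(M)=\operatorname N(\{N\in\operatorname{CM}_n:N<M\})$, $F(M)=\operatorname N(\{N\in\operatorname{CM}_n:N\le M\})$, $F^\circ(M)=F(M)\setminus F'(M)$, regarded as subspaces of $\mathcal S\mathrm t_n$. An $m$-cell is a space homeomorphic to the open $m$-ball; a closed $m$-cell is a space homeomorphic to the closed $m$-ball. A cell decomposition of $X$ is a filtration $X_0\subset X_1\subset\cdots\subset X=\bigcup_m X_m$ by closed subspaces such that each $X_m\setminus X_{m-1}$ is a disjoint union of $m$-cells. It is regular if for each cell $\sigma\subset X_m\setminus X_{m-1}$ the closure $\overline\sigma$ is a closed $m$-cell whose boundary is a union of cells. *)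

(* Defs.v *)
From HB Require Import structures.
From Stdlib Require Import Relation_Operators.
From mathcomp Require Import all_boot all_order all_algebra.
From mathcomp Require Import all_classical all_reals all_analysis.

Set Implicit Arguments.
Unset Strict Implicit.
Unset Printing Implicit Defensive.

Import Order.TTheory GRing.Theory Num.Theory numFieldNormedType.Exports.
Local Open Scope classical_set_scope.
Local Open Scope quotient_scope.

Definition nat_matrix := {pq : nat * nat & 'M[nat]_(pq.1, pq.2)}.

Definition mk_nat_matrix p q (M : 'M[nat]_(p, q)) : nat_matrix :=
  existT (fun pq : nat * nat => 'M[nat]_(pq.1, pq.2)) (p, q) M.

Definition contingency (n p q : nat) (M : 'M[nat]_(p, q)) : bool :=
  [&& [forall i, [exists j, M i j != 0%N]],
      [forall j, [exists i, M i j != 0%N]] &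
      (\sum_(i < p) \sum_(j < q) M i j == n)%N].

Definition CM (n : nat) := {M : nat_matrix | contingency n (tagged M)}.

HB.instance Definition _ n := [Choice of CM n by <:].

Definition nrows n (M : CM n) : nat := (tag (val M)).1.
Definition ncols n (M : CM n) : nat := (tag (val M)).2.

(* Rows are numbered from 0, so [i : 'I_p] designates the adjacent rows [i] and
   [i.+1] of a matrix with [p.+1] rows. *)
Definition contract_rows p q (i : 'I_p) (M : 'M[nat]_(p.+1, q)) :
    'M[nat]_(p, q) :=
  \matrix_(k < p, l < q)
    (if (k < i)%N then M (widen_ord (leqnSn p) k) l
     else if k == i then M (widen_ord (leqnSn p) k) l + M (lift ord0 k) l
     else M (lift ord0 k) l)%N.

Definition contract_cols p q (j : 'I_q) (M : 'M[nat]_(p, q.+1)) :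
    'M[nat]_(p, q) :=
  (contract_rows j M^T)^T%R.

Variant contraction : nat_matrix -> nat_matrix -> Prop :=
| RowContraction p q (i : 'I_p) (M : 'M[nat]_(p.+1, q)) :
    contraction (mk_nat_matrix M) (mk_nat_matrix (contract_rows i M))
| ColContraction p q (j : 'I_q) (M : 'M[nat]_(p, q.+1)) :
    contraction (mk_nat_matrix M) (mk_nat_matrix (contract_cols j M)).

Definition cm_contracts n : CM n -> CM n -> Prop :=
  clos_refl_trans (CM n) (fun M N => contraction (val M) (val N)).

Definition cm_le n (M N : CM n) : bool := `[< cm_contracts M N >].

Lemma cm_le_refl n : reflexive (@cm_le n).
Proof. by move=> M; apply/asboolP; exact: rt_refl. Qed.

Lemma cm_le_trans n : transitive (@cm_le n).
Proof.
by move=> N M P /asboolP MN /asboolP NP; apply/asboolP; exact: rt_trans MN NP.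
Qed.

Lemma cm_contracts_size n (M N : CM n) : cm_contracts M N ->
  M = N \/ (nrows N + ncols N < nrows M + ncols M)%N.
Proof.
elim=> [{}M {}N MN|{}M|{}M P {}N _ [->|PM] _ [<-|NP]].
- right; rewrite /nrows /ncols; case: MN => p q i A /=.
    by rewrite addSn.
  by rewrite addnS.
- by left.
- by left.
- by right.
- by right.
- by right; exact: ltn_trans NP PM.
Qed.

Lemma cm_le_anti n : antisymmetric (@cm_le n).
Proof.
move=> M N /andP[/asboolP/cm_contracts_size[//|NM]].
by move=> /asboolP/cm_contracts_size[//|]; rewrite ltnNge (ltnW NM).
Qed.

Fact cm_display : Order.disp_t. Proof. exact: Order.Disp tt tt. Qed.

HB.instance Definition _ n := Order.Le_isPOrder.Build cm_display (CM n)
  (@cm_le_refl n) (@cm_le_anti n) (@cm_le_trans n).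

Definition homeomorphism (X Y : topologicalType) (f : X -> Y) : Prop :=
  continuous f /\ exists2 g : Y -> X, continuous g & cancel f g /\ cancel g f.

Definition homeomorphic (X Y : topologicalType) : Prop :=
  exists f : X -> Y, homeomorphism f.

Section Cells.
Local Open Scope ring_scope.
Variable R : realType.

(* The norm that the library puts on row vectors is the sup norm. *)
Definition sqnorm d (x : 'rV[R]_d) : R := \sum_i x ord0 i ^+ 2.

Definition unit_open_ball d : set 'rV[R]_d := [set x | sqnorm x < 1].
Definition unit_closed_ball d : set 'rV[R]_d := [set x | sqnorm x <= 1].

(* The sphere of dimension [d - 1]; it is empty for [d = 0]. *)
Definition unit_sphere d : set 'rV[R]_d := [set x | sqnorm x = 1].

Definition open_cell (X : topologicalType) (d : nat) (A : set X) : Prop :=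
  homeomorphic A (@unit_open_ball d).

Definition closed_cell (X : topologicalType) (d : nat) (A : set X) : Prop :=
  homeomorphic A (@unit_closed_ball d).

End Cells.

Arguments unit_open_ball : clear implicits.
Arguments unit_closed_ball : clear implicits.
Arguments unit_sphere : clear implicits.

Definition stratum (X : Type) (F : nat -> set X) (m : nat) : set X :=
  F m `\` (if m is m'.+1 then F m' else set0).

(* [cells m] is the set of [m]-cells. The disjoint union in [cell_open] is one
   of spaces: every [m]-cell is open in the [m]-th stratum. *)
Record cell_decomposition (R : realType) (X : topologicalType)
    (F : nat -> set X) (cells : nat -> set (set X)) : Prop := {
  skeleton_closed : forall m, closed (F m);
  skeleton_incr : forall m, F m `<=` F m.+1;
  skeleton_cover : \bigcup_m F m = setT;
  stratum_cells : forall m, stratum F m = \bigcup_(s in cells m) s;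
  cells_disjoint : forall m, trivIset (cells m) id;
  cell_open_cell : forall m s, cells m s -> open_cell R m s;
  cell_open : forall m s, cells m s ->
    exists2 U : set X, open U & s = U `&` stratum F m
}.

(* The boundary of the closed cell [closure s] is the image of the sphere, and
   [s] is its interior. *)
Definition regular_cell_decomposition (R : realType) (X : topologicalType)
    (F : nat -> set X) (cells : nat -> set (set X)) : Prop :=
  cell_decomposition R F cells /\
  forall m s, cells m s ->
    (exists2 f : unit_closed_ball R m -> closure s, homeomorphism f &
       forall x, unit_sphere R m (val x) <-> ~ s (val (f x))) /\
    (exists2 B : set (set X), B `<=` \bigcup_k cells k &
       closure s `\` s = \bigcup_(b in B) b).

Section Nerve.
Local Open Scope ring_scope.
Variables (R : realType) (disp : Order.disp_t) (T : porderType disp).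

Definition is_chain r (t : {ffun 'I_r.+1 -> T}) : bool :=
  [forall i : 'I_r.+1, forall j : 'I_r.+1, (i <= j)%N ==> (t i <= t j)%O].

Definition nerve (r : nat) := {t : {ffun 'I_r.+1 -> T} | is_chain t}.

Definition simplex (r : nat) : set 'rV[R]_r.+1 :=
  [set x | (forall i, 0 <= x ord0 i) /\ \sum_i x ord0 i = 1].
Arguments simplex : clear implicits.

Definition simplices := {r : nat & nerve r}.

Definition nerve_sum := {t : simplices & simplex (tag t)}.

Definition mk_point r (t : nerve r) (x : simplex r) : nerve_sum :=
  existT (fun t : simplices => simplex (tag t) : Type) (existT nerve r t) x.

(* [(theta^* t, x)] is glued to [(t, theta_* x)], for [theta] a morphism
   [[s] -> [r]] of the simplex category. *)
Variant glue : nerve_sum -> nerve_sum -> Prop :=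
| Glue s r (theta : 'I_s.+1 -> 'I_r.+1) (u : nerve s) (t : nerve r)
    (x : simplex s) (y : simplex r) of
    (forall i j : 'I_s.+1, (i <= j)%N -> (theta i <= theta j)%N) &
    (forall j, val u j = val t (theta j)) &
    (forall i, val y ord0 i = \sum_(j | theta j == i) val x ord0 j) :
  glue (mk_point u x) (mk_point t y).

Definition glued (a b : nerve_sum) : bool :=
  `[< clos_refl_sym_trans nerve_sum glue a b >].

Lemma glued_refl : reflexive glued.
Proof. by move=> a; apply/asboolP; exact: rst_refl. Qed.

Lemma glued_sym : symmetric glued.
Proof. by move=> a b; apply/asboolP/asboolP; exact: rst_sym. Qed.

Lemma glued_trans : transitive glued.
Proof.
by move=> b a c /asboolP ab /asboolP bc; apply/asboolP; exact: rst_trans ab bc.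
Qed.

Definition glued_equiv : equiv_rel nerve_sum :=
  EquivRel glued glued_refl glued_sym glued_trans.

Definition realization : topologicalType :=
  quotient_topology {eq_quot glued_equiv}.

Definition real_point r (t : nerve r) (x : simplex r) : realization :=
  \pi_{eq_quot glued_equiv} (mk_point t x).

(* The image in [realization] of the realization of the nerve of [S]. *)
Definition subrealization (S : set T) : set realization :=
  [set z | exists r (t : nerve r) (x : simplex r),
     (forall i, S (val t i)) /\ z = real_point t x].

End Nerve.

Section Stochastihedron.
Variables (R : realType) (n : nat).

Definition stochastihedron : topologicalType := realization R (CM n).

Definition cellF (M : CM n) : set stochastihedron :=
  subrealization [set N | (N <= M)%O].

Definition cellF' (M : CM n) : set stochastihedron :=
  subrealization [set N | (N < M)%O].

Definition cellFo (M : CM n) : set stochastihedron := cellF M `\` cellF' M.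

End Stochastihedron.

Arguments cellF R {n} M.
Arguments cellF' R {n} M.
Arguments cellFo R {n} M.

(* Main.v *)
(** A point of St_n is a configuration of n points of C.  If z has barycentric
    coordinates w_N along a chain, and rho_N, kappa_N are the sorted row and
    column labels of N, then the sorted abscissas and ordinates are
    X(k) = sum_N w_N rho_N(k) and Y(k) = sum_N w_N kappa_N(k); the matrices of
    the chain share a matching of abscissas with ordinates.  For z in F(M),
    translate the points horizontally by rows of M and vertically by columns of
    M: what remains is a configuration in which consecutive abscissas
    (ordinates) within a row (column) of M differ by at most 1.  The
    triangulation of the cube of gaps by chains of subsets shows that every such
    configuration comes from exactly one z, and F'(M) is where the largest gap
    is 1.

    By the fundamental theorem of algebra, unordered m-tuples of complex numbers
    form C^m, via the coefficients of the polynomial with these roots.  Applied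
    to every nonzero entry of M, and modulo the p + q translations, the
    configurations of all sizes form R^(2n - (p + q)), where dilations act
    linearly once the coefficients are raised to suitable signed powers.
    Rescaling rays sends F(M) to the unit ball and F'(M) to the unit sphere. *)

From Stdlib Require Import Relation_Operators.
Require Import Defs.
From mathcomp Require Import all_fingroup all_boot all_order all_algebra.
From mathcomp Require Import all_classical all_reals all_analysis.
From mathcomp Require Import zify ring lra.
From mathcomp.real_closed Require Import complex.

Set Implicit Arguments.
Unset Strict Implicit.
Unset Printing Implicit Defensive.

Import Order.TTheory GRing.Theory Num.Theory numFieldNormedType.Exports.
Local Open Scope classical_set_scope.

(** The obstacle is that a point of a cell determines its configuration only up to renaming: a chain
    admits several matchings, and the naming of points with equal labels is arbitrary. Hence
    configurations are compared only through [sim], and no inverse of the chart is written down.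
    Injectivity rests on an invariant of [sim]. For [N < M], the total weight of the members of the
    chain that are [<= N] bounds exactly the positive [u] for which [N] can be seen in the
    configuration with all its gaps at least [u] ([separated]). These weights over all [N] give back
    the barycentric coordinates by differences. In the same way [depth] is the largest [u] attained
    by some [N < M]; as separation scales with dilations, a ray meets each positive value of [depth]
    only once. Continuity is needed in one direction only, because [CM n] is finite and so [F(M)] is
    compact. It is checked on the finitely many closed sets of points that admit a given pair of
    permutations; the point of depth 0, where the chart gives no direction, is treated apart. *)

Lemma sum_nat_eq1 p (a : nat) : (\sum_(i < p) (a == i))%N = (a < p)%N.
Proof.
have [ap|pa] := ltnP a p.
  rewrite (bigD1 (Ordinal ap))//= eqxx big1 ?addn0// => i /eqP ne.
  by case: eqP => // ai; case: ne; exact/val_inj.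
rewrite big1// => i _; case: eqP => // ai.
by move: (ltn_ord i); rewrite -ai ltnNge pa.
Qed.

Lemma sum_eq_count (T : eqType) n (F : 'I_n -> T) x :
  (\sum_k (F k == x) = count_mem x [seq F k | k <- enum 'I_n])%N.
Proof. by rewrite count_map -sum1_count big_enum_cond [RHS]big_mkcond. Qed.

Lemma leq_of_surj n p (h : 'I_n -> nat) :
  (forall a, (a < p)%N -> exists k, h k = a) -> (p <= n)%N.
Proof.
move=> hs; have [k hk] := @choice _ _ (fun (a : 'I_p) k => h k = a)
  (fun a => hs a (ltn_ord a)).
rewrite -(card_ord p) -(card_ord n).
apply: (@leq_card _ _ k) => a b ab; apply/val_inj.
by have := hk a; rewrite ab hk.
Qed.

Lemma perm_of_count (T : eqType) n (F G : 'I_n -> T) :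
  (forall x, \sum_k (F k == x) = \sum_k (G k == x))%N ->
  exists s : 'S_n, forall k, G k = F (s k).
Proof.
move=> FG.
have /tuple_permP[s Es] : perm_eq [tuple G k | k < n] [tuple F k | k < n].
  by apply/allP => x _ /=; rewrite -!sum_eq_count FG.
exists s => k; have := congr1 (fun s => nth (G k) s k) Es.
by rewrite -!tnth_nth !tnth_mktuple.
Qed.

(** * Contingency matrices as double cosets *)

Section Labellings.
Variable n : nat.
Implicit Types (f g : 'I_n -> nat) (A : nat_matrix) (N : CM n).

Local Notation rows A := (tag A).1.
Local Notation cols A := (tag A).2.

(* A contingency matrix is an orbit of pairs of labellings of [n] points. *)
Record labels A f g : Prop := Labels {
  labels_row : forall k, (f k < rows A)%N;
  labels_col : forall k, (g k < cols A)%N;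
  labels_count : forall i j,
    tagged A i j = (\sum_k ((f k == i) && (g k == j)))%N }.

Lemma labels_tr p q (M : 'M[nat]_(p, q)) f g :
  labels (mk_nat_matrix M) f g -> labels (mk_nat_matrix M^T%R) g f.
Proof.
case=> fp gq c; split=> // i j; rewrite /= mxE [LHS](c j i).
by under eq_bigr do rewrite andbC.
Qed.

(** Contractions act on labellings by composition with this monotone map, which turns the order on
    matrices into coarsening of labels. *)
Definition contract_index i a := if (a <= i)%N then a else a.-1.

Lemma leq_contract_index i a b :
  (a <= b)%N -> (contract_index i a <= contract_index i b)%N.
Proof. by rewrite /contract_index; do 2!case: ifP; lia. Qed.

Lemma labels_contract_rows p q (i : 'I_p) (M : 'M[nat]_(p.+1, q)) f g :
  labels (mk_nat_matrix M) f g ->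
  labels (mk_nat_matrix (contract_rows i M)) (contract_index i \o f) g.
Proof.
case=> /= fp gq c; split=> //= [k|k l].
  by have := fp k; rewrite /contract_index /=; have := ltn_ord i; case: ifP;
    lia.
rewrite mxE !c -big_split /=.
have iN := ltn_ord i.
case: ifPn => [ki|]; last case: ifPn => [/eqP ->|].
- apply: eq_bigr => x _; congr (nat_of_bool (_ && _)).
  by rewrite /contract_index; case: ifP; lia.
- move=> _; apply: eq_bigr => x _; rewrite /contract_index /= /bump /=.
  by case: (g x == l); rewrite ?andbF// !andbT; case: ifP; lia.
- move=> ki; rewrite -leqNgt => ik.
  have {}ki : (k : nat) <> i by move/val_inj/eqP; apply/negP.
  apply: eq_bigr => x _; congr (nat_of_bool (_ && _)).
  by rewrite /contract_index /= /bump /=; case: ifP; lia.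
Qed.

Lemma labels_contract_cols p q (j : 'I_q) (M : 'M[nat]_(p, q.+1)) f g :
  labels (mk_nat_matrix M) f g ->
  labels (mk_nat_matrix (contract_cols j M)) f (contract_index j \o g).
Proof. by move=> /labels_tr/(labels_contract_rows j)/labels_tr. Qed.

Lemma labels_contingency A f g : labels A f g ->
  (forall a, (a < rows A)%N -> exists k, f k = a) ->
  (forall b, (b < cols A)%N -> exists k, g k = b) ->
  contingency n (tagged A).
Proof.
case: A => -[p q] M [/= fp gq c] fs gs; apply/and3P; split.
- apply/forallP => i; have [k fk] := fs i (ltn_ord i).
  apply/existsP; exists (Ordinal (gq k)); rewrite c (bigD1 k)//= fk !eqxx.
  by rewrite add1n.
- apply/forallP => j; have [k gk] := gs j (ltn_ord j).
  apply/existsP; exists (Ordinal (fp k)); rewrite c (bigD1 k)//= gk !eqxx.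
  by rewrite add1n.
- under eq_bigr => i _ do under eq_bigr => j _ do rewrite c.
  under eq_bigr => i _ do rewrite exchange_big.
  rewrite exchange_big /= -[X in _ == X]card_ord -sum1_card; apply/eqP.
  apply: eq_bigr => k _.
  transitivity (\sum_(i < p) (f k == i))%N; last by rewrite sum_nat_eq1 fp.
  apply: eq_bigr => i _; case: (f k == i); last by rewrite big1.
  by rewrite sum_nat_eq1 gq.
Qed.

Lemma labels_surj A f g : labels A f g -> contingency n (tagged A) ->
  (forall a, (a < rows A)%N -> exists k, f k = a) /\
  (forall b, (b < cols A)%N -> exists k, g k = b).
Proof.
case: A => -[p q] M [/= fp gq c] /and3P[/forallP r0 /forallP c0 _].
have key i j : M i j != 0%N -> exists2 k, f k = i & g k = j.
  rewrite c -lt0n => s0; apply: contrapT => nok; move: s0.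
  rewrite big1// => k _; have [/= fk|//] := eqVneq (f k) i.
  by have [gk|] := eqVneq (g k) j => //; case: nok; exists k.
split=> a lta.
  by have /existsP[j /key[k fk _]] := r0 (Ordinal lta); exists k.
by have /existsP[i /key[k _ gk]] := c0 (Ordinal lta); exists k.
Qed.

Lemma labels_inj A B f g : labels A f g -> labels B f g ->
  contingency n (tagged A) -> contingency n (tagged B) -> A = B.
Proof.
case: A B => -[p q] M [[p' q'] M'] LA LB cA cB.
have [/= fA gA] := labels_surj LA cA; have [/= fB gB] := labels_surj LB cB.
have pp (a b : nat) h : (forall k, h k < a)%N ->
    (forall x, (x < b)%N -> exists k : 'I_n, h k = x) -> (b <= a)%N.
  by move=> ha hb; case: b hb => // b /(_ b (ltnSn b)) [k <-].
have pE : p = p'.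
  by apply/eqP; rewrite eqn_leq (pp p' p f (labels_row LB))// (pp p p' f
    (labels_row LA)).
have qE : q = q'.
  by apply/eqP; rewrite eqn_leq (pp q' q g (labels_col LB))// (pp q q' g
    (labels_col LA)).
subst p' q'; congr (existT _ _ _); apply/matrixP => i j.
by have := labels_count LA i j; have /= <- := labels_count LB i j.
Qed.

Definition mkCM A (cA : contingency n (tagged A)) : CM n :=
  exist (fun M : nat_matrix => contingency n (tagged M)) A cA.

Definition lab N f g := labels (val N) f g.

Lemma lab_contingency N : contingency n (tagged (val N)).
Proof. by case: N. Qed.

Lemma lab_inj N N' f g : lab N f g -> lab N' f g -> N = N'.
Proof.
by move=> L L'; apply/val_inj/(labels_inj L L'); exact: lab_contingency.
Qed.

Lemma lab_row_surj N f g : lab N f g ->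
  forall a, (a < nrows N)%N -> exists k, f k = a.
Proof. by move=> L; have [] := labels_surj L (lab_contingency N). Qed.

Lemma lab_col_surj N f g : lab N f g ->
  forall b, (b < ncols N)%N -> exists k, g k = b.
Proof. by move=> L; have [] := labels_surj L (lab_contingency N). Qed.

Lemma lab_comp_perm N f g (s : 'S_n) :
  lab N f g -> lab N (f \o s) (g \o s).
Proof.
case=> fp gq c; split=> [k|k|i j]; [exact: fp|exact: gq|].
by rewrite c (reindex_inj (@perm_inj _ s)).
Qed.

(** Both pairs of labellings take a value [(i, j)] as often as the entry of the matrix tells, and
    values outside of its range never. *)
Lemma lab_perm N f g f' g' : lab N f g -> lab N f' g' ->
  exists s : 'S_n, (forall k, f' k = f (s k)) /\ (forall k, g' k = g (s k)).
Proof.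
move=> L L'; have [[a b]|s Es] := @perm_of_count _ _
    (fun k => (f k, g k)) (fun k => (f' k, g' k)).
  have [ap|pa] := ltnP a (nrows N); last first.
    rewrite !big1// => k _; case: eqP => // -[E _]; move: pa.
      by rewrite -E leqNgt (labels_row L').
    by rewrite -E leqNgt (labels_row L).
  have [bq|qb] := ltnP b (ncols N); last first.
    rewrite !big1// => k _; case: eqP => // -[_ E]; move: qb.
      by rewrite -E leqNgt (labels_col L').
    by rewrite -E leqNgt (labels_col L).
  transitivity (tagged (val N) (Ordinal ap) (Ordinal bq)).
    by rewrite (labels_count L).
  by rewrite (labels_count L').
by exists s; split=> k; case: (Es k).
Qed.

Lemma lab_ex N : exists f g, lab N f g.
Proof.
case: N => -[[p q] M] cM.
have /and3P[_ _ /eqP Mn] := cM.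
(* Each position is listed as often as its entry says; the list has length [n], and its [k]-th
   element labels the point [k]. *)
pose s := flatten [seq nseq (M ij.1 ij.2) (ij.1 : nat,
  ij.2 : nat) | ij : 'I_p * 'I_q].
have size_s : size s = n.
  rewrite size_flatten /shape -map_comp sumnE big_map -[RHS]Mn /=.
  by rewrite big_enum pair_bigA /=; apply: eq_bigr => -[i j] _;
    rewrite size_nseq.
have mem_s x : x \in s -> (x.1 < p)%N /\ (x.2 < q)%N.
  by move=> /flattenP[_ /mapP[[i j] _ ->]] /nseqP[-> _] /=; rewrite !ltn_ord.
have nth_s (k : 'I_n) : nth (0, 0)%N s k \in s by rewrite mem_nth// size_s.
exists (fun k => (nth (0, 0)%N s k).1), (fun k => (nth (0, 0)%N s k).2).
split=> [k|k|/= i j]; do ?by have [] := mem_s _ (nth_s k).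
transitivity (count (fun x => (x.1 == i :> nat) && (x.2 == j :> nat)) s).
  rewrite count_flatten -map_comp sumnE big_map big_enum /=.
  rewrite (bigD1 (i, j))//= count_nseq /= !eqxx mul1n big1 ?addn0//.
  move=> [i' j'] /eqP ne; rewrite count_nseq /=.
  case: eqP => //= /val_inj ii; case: eqP => //= /val_inj jj.
  by case: ne; rewrite ii jj.
rewrite -sum1_count (big_nth (0, 0)%N) size_s big_mkord big_mkcond.
by apply: eq_bigr => k _; case: ifP.
Qed.

Lemma contraction_lab A B f g : Defs.contraction A B -> labels A f g ->
  exists al be : nat -> nat,
    [/\ {homo al : a b / (a <= b)%N}, {homo be : a b / (a <= b)%N} &
        labels B (al \o f) (be \o g)].
Proof.
case=> p q i M L.
  exists (contract_index i), id; split=> //; first exact: leq_contract_index.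
  exact: labels_contract_rows.
exists id, (contract_index i); split=> //; first exact: leq_contract_index.
exact: labels_contract_cols.
Qed.

Lemma le_lab N N' f g : (N <= N')%O -> lab N f g ->
  exists al be : nat -> nat,
    [/\ {homo al : a b / (a <= b)%N}, {homo be : a b / (a <= b)%N} &
        lab N' (al \o f) (be \o g)].
Proof.
move=> /asboolP NN'; elim: NN' f g => {N N'}.
- by move=> N N' c f g; exact: contraction_lab.
- by move=> N f g L; exists id, id; split.
- move=> N1 N2 N3 _ IH12 _ IH23 f g /IH12[al [be [mal mbe]]].
  move=> /IH23[al' [be' [mal' mbe' L]]].
  by exists (al' \o al), (be' \o be); split=> // a b ab /=;
    [exact/mal'/mal|exact/mbe'/mbe].
Qed.

(** If [f l < f k] but [f' k <= f' l], monotonicity forces [f'] to be constant on the two rows [f l]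
    and [(f l).+1]; contracting these two stays finer than [f']. *)
Lemma refine_contract p f f' (fp : forall k, (f k < p)%N) :
  (forall a, (a < p)%N -> exists k, f k = a) ->
  (forall k l, (f k <= f l)%N -> (f' k <= f' l)%N) ->
  (forall k l, (f' k <= f' l)%N -> (f k <= f l)%N) \/
  exists2 i, (i.+1 < p)%N & forall k l,
    (contract_index i (f k) <= contract_index i (f l))%N -> (f' k <= f' l)%N.
Proof.
move=> fs ff'.
have [|/existsNP[k /existsNP[l /not_implyP[kl /negP]]]] :=
  pselect (forall k l, (f' k <= f' l)%N -> (f k <= f l)%N); first by left.
rewrite -ltnNge => lk; right; exists (f l).
  by rewrite (leq_ltn_trans lk).
move=> x y; rewrite /contract_index => xy.
have [|yx] := leqP (f x) (f y); first exact: ff'.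
have [fx fy] : f x = (f l).+1 /\ f y = f l.
  by move: xy; do 2!case: ifP; lia.
apply: (@leq_trans (f' k)); first by apply: ff'; rewrite fx.
by apply: (leq_trans kl); apply: ff'; rewrite fy.
Qed.

(** Induction on the number of rows and columns: while the labels of [N] are strictly finer, one
    contraction splits off. In the end both labellings induce the same preorder and, being onto
    initial segments, coincide. *)
Lemma lab_le N N' f g f' g' : lab N f g -> lab N' f' g' ->
  (forall k l, (f k <= f l)%N -> (f' k <= f' l)%N) ->
  (forall k l, (g k <= g l)%N -> (g' k <= g' l)%N) -> (N <= N')%O.
Proof.
have [m] := ubnP (nrows N + ncols N); elim: m N f g =>
  // m IH N f g Nm L L' ff' gg'.
have [fs gs] := labels_surj L (lab_contingency N).
have [f'f|[i ip fi]] := refine_contract (labels_row L) fs ff'; last first.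
  case: N Nm L fs gs ip => -[[[//|p] q] M] cM Nm L fs gs ip.
  have iP : (i < p)%N by [].
  have L1 := @labels_contract_rows _ _ (Ordinal iP) _ _ _ L.
  have c1 : contingency n
      (tagged (mk_nat_matrix (contract_rows (Ordinal iP) M))).
    apply: (labels_contingency L1) => //= a ap.
    have [ai|ia] := leqP a i.
      by have [|k fk] := fs a; [rewrite /= (leq_trans ap)|exists k;
        rewrite fk /contract_index ai].
    have [|k fk] := fs a.+1; first by [].
    by exists k; rewrite fk /contract_index leqNgt ltnS (ltnW ia).
  pose N1 := mkCM c1.
  apply: (@le_trans _ _ N1); first by apply/asboolP/rt_step/RowContraction.
  apply: (IH N1 (contract_index i \o f) g) => //.
have [g'g|[j jq gj]] := refine_contract (labels_col L) gs gg'; last first.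
  case: N Nm L fs gs jq => -[[p [//|q]] M] cM Nm L fs gs jq.
  have jP : (j < q)%N by [].
  have L1 := @labels_contract_cols _ _ (Ordinal jP) _ _ _ L.
  have c1 : contingency n
      (tagged (mk_nat_matrix (contract_cols (Ordinal jP) M))).
    apply: (labels_contingency L1) => //= a ap.
    have [ai|ia] := leqP a j.
      by have [|k fk] := gs a; [rewrite /= (leq_trans ap)|exists k;
        rewrite fk /contract_index ai].
    have [|k fk] := gs a.+1; first by [].
    by exists k; rewrite fk /contract_index leqNgt ltnS (ltnW ia).
  pose N1 := mkCM c1.
  apply: (@le_trans _ _ N1); first by apply/asboolP/rt_step/ColContraction.
  apply: (IH N1 f (contract_index j \o g)) => //.
  by move: Nm; rewrite /nrows /ncols /= addnS.
suff -> : N = N' by [].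
have same h h' a b : (forall k, h k < a)%N -> (forall k, h' k < b)%N ->
   (forall x, (x < a)%N -> exists k : 'I_n, h k = x) ->
   (forall x, (x < b)%N -> exists k : 'I_n, h' k = x) ->
   (forall k l, (h k <= h l)%N -> (h' k <= h' l)%N) ->
   (forall k l, (h' k <= h' l)%N -> (h k <= h l)%N) ->
   forall k, h k = h' k.
  move=> ha hb sa sb hh' h'h k.
  have [d] := ubnP (h k); elim: d k => // d IHd k; rewrite ltnS => hkd.
  have le1 : (h k <= h' k)%N.
    case hkE : (h k) => [//|x]; have [|l hl] := sa x.
      by rewrite (ltn_trans _ (ha k))// hkE.
    have hlk : (h l < h k)%N by rewrite hl hkE.
    have <- : h' l = x by rewrite -IHd ?hl// -hkE.
    by rewrite ltnNge; apply/negP => /h'h; rewrite leqNgt hlk.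
  apply/eqP; rewrite eqn_leq le1 /= leqNgt; apply/negP => lt1.
  have [|l h'l] := sb (h k); first exact: ltn_trans lt1 (hb k).
  have hlk : (h l < h k)%N.
    by rewrite ltnNge; apply/negP => /hh'; rewrite leqNgt h'l lt1.
  by have := IHd l (leq_trans hlk hkd); rewrite h'l => E; rewrite E ltnn in hlk.
have [fs' gs'] := labels_surj L' (lab_contingency N').
apply: (@lab_inj _ _ f g) => //.
suff [-> ->] : f = f' /\ g = g' by [].
split; apply/funext.
  by apply: same (labels_row L) (labels_row L') _ _ _ _.
by apply: same (labels_col L) (labels_col L') _ _ _ _.
Qed.

Lemma exists_lab p q f g :
  (forall k, (f k < p)%N) -> (forall a, (a < p)%N -> exists k, f k = a) ->
  (forall k, (g k < q)%N) -> (forall b, (b < q)%N -> exists k, g k = b) ->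
  exists N, lab N f g.
Proof.
move=> fp fs gq gs.
pose M : 'M[nat]_(p, q) := (\matrix_(i, j) (\sum_k ((f k == i) && (g k ==
  j)))%N)%R.
have L : labels (mk_nat_matrix M) f g by split=> // i j; rewrite /= mxE.
by exists (mkCM (labels_contingency L fs gs)).
Qed.

(** * Sorted labels, sheets and cuts *)

Definition sorted_fun (f : 'I_n -> nat) (k : 'I_n) : nat :=
  nth 0%N (sort leq (codom f)) k.

Lemma sorted_fun_mono f (k l : 'I_n) :
  (k <= l)%N -> (sorted_fun f k <= sorted_fun f l)%N.
Proof.
move=> kl; apply: (sorted_leq_nth leq_trans leqnn) => //.
- exact: (sort_sorted leq_total).
- by rewrite inE size_sort size_codom card_ord.
- by rewrite inE size_sort size_codom card_ord.
Qed.

Lemma codom_ord_nth f (s : seq nat) : size s = n ->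
  (forall k : 'I_n, nth 0%N s k = f k) -> s = codom f.
Proof.
move=> sn sf; apply: (@eq_from_nth _ 0%N); first by rewrite size_codom card_ord.
move=> i; rewrite sn => ltin; rewrite codomE (nth_map (Ordinal ltin))
  ?size_enum_ord//.
by rewrite -(sf (nth _ _ _)) nth_enum_ord.
Qed.

Lemma codom_sorted_fun f : codom (sorted_fun f) = sort leq (codom f).
Proof. by apply/esym/codom_ord_nth => //; rewrite size_sort size_codom
  card_ord. Qed.

Lemma sorted_fun_perm f : exists s : 'S_n, forall k, f k = sorted_fun f (s k).
Proof.
apply: perm_of_count => x.
by rewrite !sum_eq_count -!codomE codom_sorted_fun count_sort.
Qed.

Lemma sorted_fun_unique f (s : 'S_n) r :
  (forall k l : 'I_n, (k <= l)%N -> (r k <= r l)%N) ->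
  (forall k, f k = r (s k)) -> r = sorted_fun f.
Proof.
move=> rm fr.
have r_sorted : sorted leq (codom r).
  rewrite codomE sorted_map.
  apply: (@sub_sorted _ (relpre val leq)) => [k l|]; first exact: rm.
  by rewrite -sorted_map val_enum_ord iota_sorted.
have pE : perm_eq (codom f) (codom r).
  apply/allP => x _ /=; apply/eqP.
  rewrite !codomE -!sum_eq_count [RHS](reindex_inj (@perm_inj _ s)).
  by apply: eq_bigr => k _; rewrite fr.
have rE : codom r = sort leq (codom f).
  apply: (sorted_eq leq_trans anti_leq) => //; first exact: (sort_sorted
    leq_total).
  by rewrite perm_sym perm_sort.
apply/funext => k; rewrite /sorted_fun -rE codomE (nth_map k) ?size_enum_ord//.
by rewrite nth_ord_enum.
Qed.

(** The sorted list does not depend on the labelling picked, since any two labellings of [N] differ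
    by a permutation of the points. *)
Definition rho N := sorted_fun (xget (fun=> 0%N) [set f | exists g, lab N f g]).
Definition kappa N :=
  sorted_fun (xget (fun=> 0%N) [set g | exists f, lab N f g]).

Lemma rho_mono N (k l : 'I_n) : (k <= l)%N -> (rho N k <= rho N l)%N.
Proof. exact: sorted_fun_mono. Qed.

Lemma kappa_mono N (k l : 'I_n) : (k <= l)%N -> (kappa N k <= kappa N l)%N.
Proof. exact: sorted_fun_mono. Qed.

Lemma rhoE N f g : lab N f g -> rho N = sorted_fun f.
Proof.
move=> L; rewrite /rho; case: xgetP => [f' _ [g' L']|/(_ f) nof];
  last by case: nof; exists g.
have [s [fs _]] := lab_perm L' L; have [t ft] := sorted_fun_perm f'.
apply: (@sorted_fun_unique _ (s * t)%g); first exact: sorted_fun_mono.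
by move=> k; rewrite permM -ft fs.
Qed.

Lemma kappaE N f g : lab N f g -> kappa N = sorted_fun g.
Proof.
move=> L; rewrite /kappa; case: xgetP => [g' _ [f' L']|/(_ g) nog];
  last by case: nog; exists f.
have [s [_ fs]] := lab_perm L' L; have [t ft] := sorted_fun_perm g'.
apply: (@sorted_fun_unique _ (s * t)%g); first exact: sorted_fun_mono.
by move=> k; rewrite permM -ft fs.
Qed.

(* [rho N] and [kappa N] are the sorted row and column labels, and the
   matchings [s.1^-1 * s.2] of the [s] in [sheet N] form the double coset of
   'S_n attached to [N]. *)
Definition sheet N (s : 'S_n * 'S_n) := lab N (rho N \o s.1) (kappa N \o s.2).

Lemma lab_sheet N f g : lab N f g -> exists2 s, sheet N s &
  f = rho N \o s.1 /\ g = kappa N \o s.2.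
Proof.
move=> L; have [s fs] := sorted_fun_perm f; have [t gt] := sorted_fun_perm g.
have E : f = rho N \o s /\ g = kappa N \o t.
  by split; apply/funext => k; rewrite /= ?(rhoE L) ?(kappaE L).
by exists (s, t) => //; move: L; rewrite {1}E.1 {1}E.2.
Qed.

Lemma sheet_ex N : exists s, sheet N s.
Proof. by have [f [g /lab_sheet[s Ls _]]] := lab_ex N; exists s. Qed.

(** A monotone relabelling of a sorted list is sorted, so a contraction takes [rho N] to [rho N']
    without touching the permutations. Thus a sheet of the least matrix of a chain serves the whole
    chain. *)
Lemma sheet_le N N' s : (N <= N')%O -> sheet N s ->
  [/\ sheet N' s,
    forall k l, (rho N k <= rho N l)%N -> (rho N' k <= rho N' l)%N &
    forall k l, (kappa N k <= kappa N l)%N -> (kappa N' k <= kappa N' l)%N].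
Proof.
move=> NN' L; have [al [be [mal mbe L']]] := le_lab NN' L.
have rE : al \o rho N = rho N'.
  rewrite (rhoE L'); apply: (@sorted_fun_unique _ s.1) => // k l kl.
  exact/mal/rho_mono.
have kE : be \o kappa N = kappa N'.
  rewrite (kappaE L'); apply: (@sorted_fun_unique _ s.2) => // k l kl.
  exact/mbe/kappa_mono.
split; first by rewrite /sheet -rE -kE.
  by move=> k l kl; rewrite -rE; exact: mal.
by move=> k l kl; rewrite -kE; exact: mbe.
Qed.

Lemma rho_le N N' : (N <= N')%O ->
  forall k l, (rho N k <= rho N l)%N -> (rho N' k <= rho N' l)%N.
Proof. by have [s Ns] := sheet_ex N => /sheet_le/(_ Ns)[]. Qed.

Lemma kappa_le N N' : (N <= N')%O ->
  forall k l, (kappa N k <= kappa N l)%N -> (kappa N' k <= kappa N' l)%N.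
Proof. by have [s Ns] := sheet_ex N => /sheet_le/(_ Ns)[]. Qed.

Lemma le_sheet N N' s : sheet N s -> sheet N' s ->
  (forall k l, (rho N k <= rho N l)%N -> (rho N' k <= rho N' l)%N) ->
  (forall k l, (kappa N k <= kappa N l)%N -> (kappa N' k <= kappa N' l)%N) ->
  (N <= N')%O.
Proof. by move=> L L' rr kk; apply: (lab_le L L') => k l;
  [exact: rr|exact: kk]. Qed.

Lemma rho_surj N a : (a < nrows N)%N -> exists k, rho N k = a.
Proof.
by have [s L] := sheet_ex N => /(lab_row_surj L)[k <-]; exists (s.1 k).
Qed.

Lemma kappa_surj N a : (a < ncols N)%N -> exists k, kappa N k = a.
Proof.
by have [s L] := sheet_ex N => /(lab_col_surj L)[k <-]; exists (s.2 k).
Qed.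

Lemma rho_lt N k : (rho N k < nrows N)%N.
Proof.
have [s L] := sheet_ex N; have := labels_row L (s.1^-1%g k).
by rewrite /= permKV.
Qed.

Lemma kappa_lt N k : (kappa N k < ncols N)%N.
Proof.
have [s L] := sheet_ex N; have := labels_col L (s.2^-1%g k).
by rewrite /= permKV.
Qed.

Lemma step_of_surj (r : 'I_n -> nat) p :
  (forall k l : 'I_n, (k <= l)%N -> (r k <= r l)%N) ->
  (forall k, (r k < p)%N) -> (forall a, (a < p)%N -> exists k, r k = a) ->
  forall k l : 'I_n, l = k.+1 :> nat -> (r l <= (r k).+1)%N.
Proof.
move=> rm rp rs k l lk; rewrite leqNgt; apply/negP => kl.
have [|x rx] := rs (r k).+1; first exact: ltn_trans kl (rp l).
have [xk|] := leqP x k; first by have := rm _ _ xk; rewrite rx ltnn.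
by rewrite -lk => /rm; rewrite rx leqNgt kl.
Qed.

Lemma rho_step N (k l : 'I_n) : l = k.+1 :> nat -> (rho N l <= (rho N k).+1)%N.
Proof.
apply: (@step_of_surj _ (nrows N)); [exact: rho_mono|exact: rho_lt|].
exact: rho_surj.
Qed.

Lemma kappa_step N (k l : 'I_n) :
  l = k.+1 :> nat -> (kappa N l <= (kappa N k).+1)%N.
Proof.
apply: (@step_of_surj _ (ncols N)); [exact: kappa_mono|exact: kappa_lt|].
exact: kappa_surj.
Qed.

(* The row labels of the composition of [n] that is cut before the positions
   in [D]. *)
Definition cut_fun (D : pred nat) (k : 'I_n) : nat :=
  (\sum_(1 <= j < k.+1) D j)%N.

Lemma cut_fun_mono D (k l : 'I_n) :
  (k <= l)%N -> (cut_fun D k <= cut_fun D l)%N.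
Proof.
move=> kl; rewrite /cut_fun [leqRHS](@big_cat_nat _ _ _ k.+1)//=.
exact: leq_addr.
Qed.

Lemma cut_fun_step D (k l : 'I_n) : l = k.+1 :> nat ->
  cut_fun D l = (cut_fun D k + D l)%N.
Proof. by move=> lk; rewrite /cut_fun lk big_nat_recr. Qed.

Lemma cut_fun_range D : (0 < n)%N -> exists p,
  (forall k, (cut_fun D k < p)%N) /\
  (forall a, (a < p)%N -> exists k, cut_fun D k = a).
Proof.
move=> n0; exists (\sum_(1 <= j < n) D j).+1; split=> [k|a].
  by rewrite ltnS /cut_fun [leqRHS](@big_cat_nat _ _ _ k.+1)//= leq_addr.
rewrite ltnS => ap.
have ex : exists m, (a <= \sum_(1 <= j < m.+1) D j)%N by exists n.-1;
  rewrite prednK.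
(* At the first position where the number of cuts reaches [a] it equals [a], because it grows by at
   most one per position. *)
case: (ex_minnP ex) => m am m_min.
have mn : (m < n)%N by rewrite -(prednK n0) ltnS m_min// prednK.
exists (Ordinal mn); apply/eqP; rewrite /cut_fun /= eqn_leq am andbT.
case: m am m_min {mn} => [|m] am m_min; first by rewrite big_geq.
have am' : ~~ (a <= \sum_(1 <= j < m.+1) D j)%N.
  by apply/negP => /m_min; rewrite ltnn.
by rewrite big_nat_recr//=; case: (D m.+1); move: am'; lia.
Qed.

(** Once the permutations are fixed, row cuts and column cuts are free; the chains that prove
    surjectivity are built from this. *)
Lemma sheet_of_cuts D E (s : 'S_n * 'S_n) : (0 < n)%N ->
  exists N, [/\ sheet N s, rho N = cut_fun D & kappa N = cut_fun E].
Proof.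
move=> n0; have [p [Dp Ds]] := cut_fun_range D n0.
have [q [Eq Es]] := cut_fun_range E n0.
have [N L] : exists N, lab N (cut_fun D \o s.1) (cut_fun E \o s.2).
  apply: (@exists_lab p q) => [k|a ap|k|b bq]; [exact: Dp| |exact: Eq|].
    by have [k <-] := Ds _ ap; exists (s.1^-1%g k); rewrite /= permKV.
  by have [k <-] := Es _ bq; exists (s.2^-1%g k); rewrite /= permKV.
have rE : rho N = cut_fun D.
  rewrite (rhoE L); apply/esym/(@sorted_fun_unique _ s.1) => //.
  exact: cut_fun_mono.
have kE : kappa N = cut_fun E.
  rewrite (kappaE L); apply/esym/(@sorted_fun_unique _ s.2) => //.
  exact: cut_fun_mono.
by exists N; rewrite /sheet rE kE.
Qed.

(** A matrix is recovered from any of its labellings, and labels are bounded by [n]. *)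
Lemma CM_finite : exists s : seq (CM n), forall N, N \in s.
Proof.
pose I := ({ffun 'I_n -> 'I_n.+1} * {ffun 'I_n -> 'I_n.+1})%type.
pose dec (fg : I) : option (CM n) :=
  if pselect (exists N, lab N (fun k => fg.1 k) (fun k => fg.2 k)) is left ex
  then Some (projT1 (cid ex)) else None.
exists (pmap dec (enum (I : finType))) => N.
rewrite mem_pmap; apply/mapP.
have [f [g L]] := lab_ex N.
have fn k : (f k < n.+1)%N.
  rewrite ltnS (leq_trans (ltnW (labels_row L k)))//.
  exact/leq_of_surj/(lab_row_surj L).
have gn k : (g k < n.+1)%N.
  rewrite ltnS (leq_trans (ltnW (labels_col L k)))//.
  exact/leq_of_surj/(lab_col_surj L).
pose fg : I := ([ffun k => Ordinal (fn k)], [ffun k => Ordinal (gn k)]).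
exists fg; first by rewrite mem_enum.
have L' : lab N (fun k => fg.1 k) (fun k => fg.2 k).
  suff [-> ->] : (fun k => fg.1 k : nat) = f /\
    (fun k => fg.2 k : nat) = g by [].
  by split; apply/funext => k; rewrite ffunE.
rewrite /dec; case: pselect => [ex|]; last by case; exists N.
by congr Some; apply: lab_inj L' _; case: (cid ex).
Qed.

End Labellings.

Local Open Scope ring_scope.

(** * Realization of the nerve of a poset *)

Lemma compact_set_type (X : topologicalType) (A : set X) :
  compact A -> compact [set: A].
Proof.
move=> cA F FF _.
have [x [Ax clx]] : exists x, A x /\ cluster (val @ F) x.
  apply: cA.
  by apply: (@filterS _ F _ setT); [move=> a _; exact: set_valP|exact: filterT].
exists (SigSub (mem_set Ax)); split=> // B C FB [V [[W oW WV] Vx VC]].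
have [||_ [[b Bb <-] Wb]] := clx (val @` B) W.
- by apply: (@filterS _ F _ B) => // b Bb; exists b.
- by apply: open_nbhs_nbhs; split=> //; rewrite -WV in Vx.
- by exists b; split=> //; apply: VC; rewrite -WV.
Qed.

Lemma continuous_sum (R : realType) (X : topologicalType) (I : Type)
    (s : seq I) (P : pred I) (f : I -> X -> R) :
  (forall i, P i -> continuous (f i)) ->
  continuous (fun x => \sum_(i <- s | P i) f i x).
Proof. by move=> cf; apply: continuous_big => //; exact: add_continuous. Qed.

Lemma continuous_set_val_coord (R : realType) d (A : set 'rV[R]_d) i :
  continuous (fun x : A => val x ord0 i).
Proof.
move=> x.
have := @continuous_comp _ _ _ (val : A -> _) (fun y : 'rV[R]_d => y ord0 i) x.
apply.
  exact: initial_continuous.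
exact: coord_continuous.
Qed.

Lemma continuous_set_val_linear (R : realType) d (A : set 'rV[R]_d) c :
  continuous (fun x : A => \sum_i val x ord0 i * c i).
Proof.
apply: continuous_sum => i _ x.
apply: (@continuousM _ A (fun x : A => val x ord0 i) (fun=> c i)).
  exact: continuous_set_val_coord.
by move=> ?; exact: cst_continuous.
Qed.

Section NerveTheory.
Local Open Scope quotient_scope.
Variables (R : realType) (disp : Order.disp_t) (T : porderType disp).
Implicit Types (h : T -> R) (z : realization R T).

Definition prelin h (a : nerve_sum R T) : R :=
  \sum_i val (projT2 a) ord0 i * h (val (projT2 (projT1 a)) i).

(* The affine extension of [h] from the vertices to the realization. *)
Definition lin h z : R := prelin h (repr z).

(** Pushing weights forward along [theta] is adjoint to pulling vertices back along it. *)
Lemma prelin_glue h a b : Defs.glue a b -> prelin h a = prelin h b.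
Proof.
case=> s r theta u t x y mono ut yx; rewrite /prelin /=.
under [RHS]eq_bigr => i _ do rewrite yx mulr_suml.
rewrite (exchange_big_dep xpredT)//=; apply: eq_bigr => j _.
by rewrite (big_pred1 (theta j)) ?ut// => i /=; rewrite eq_sym.
Qed.

Lemma prelin_glued h a b : glued a b -> prelin h a = prelin h b.
Proof.
by move=> /asboolP; elim=> // [? ?|? ? ? _ -> _ ->]//; exact: prelin_glue.
Qed.

Lemma linE h r (t : nerve T r) (x : @simplex R r) :
  lin h (real_point t x) = \sum_i val x ord0 i * h (val t i).
Proof.
rewrite /lin (@prelin_glued h _ (mk_point t x))//.
by have /eqmodP := reprK (real_point t x).
Qed.

Lemma real_pointP z : exists r (t : nerve T r) (x : @simplex R r),
  z = real_point t x.
Proof.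
rewrite -[z]reprK; case: (repr z) => -[r t] x.
by exists r, t, x.
Qed.

Lemma continuous_lin h : continuous (lin h).
Proof.
pose f (t : simplices T) (x : @simplex R (tag t)) :=
  \sum_i val x ord0 i * h (val (projT2 t) i).
have cf : continuous (unstable.sigT_fun f).
  apply: sigT_continuous => -[r t].
  exact: (@continuous_set_val_linear R _ (@simplex R r)).
have fE : unstable.sigT_fun f =
    lin h \o \pi_{eq_quot (@glued_equiv R disp T)}.
  by apply/funext => -[[r t] x]; exact: (esym (linE h t x)).
by apply/quotient_continuous; rewrite fE in cf.
Qed.


(** The vertices of the open simplex that contains [z]: a nonempty finite chain. *)
Definition supp z : set T := [set a | 0 < lin (fun b => (b == a)%:R) z].

Section Representative.
Variables (r : nat) (t : nerve T r) (x : @simplex R r).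

Lemma simplex_ge0 i : 0 <= val x ord0 i.
Proof. by have [+ _] := set_valP x; exact. Qed.

Lemma simplex_sum1 : \sum_i val x ord0 i = 1.
Proof. by have [_] := set_valP x. Qed.

Lemma nerve_mono (i j : 'I_r.+1) : (i <= j)%N -> (val t i <= val t j)%O.
Proof. by move: i j; have /'forall_'forall_implyP := valP t. Qed.

Lemma supp_real_pointP a :
  supp (real_point t x) a <-> exists2 i, 0 < val x ord0 i & val t i = a.
Proof.
rewrite /supp /= linE; split=> [s0|[i xi <-]].
  apply: contrapT => noi; suff: (\sum_i val x ord0 i * (val t i == a)%:R <= 0).
    by rewrite leNgt s0.
  apply: sumr_le0 => i _; case: eqP => [tia|_]; last by rewrite mulr0.
  rewrite mulr1 leNgt; apply/negP => xi; apply: noi; by exists i.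
rewrite (bigD1 i)//= eqxx mulr1 ltr_pwDl// sumr_ge0// => j _.
by rewrite mulr_ge0// simplex_ge0.
Qed.

End Representative.

Lemma simplex_push r s (theta : 'I_s.+1 -> 'I_r.+1) (x : @simplex R s) :
  exists y : @simplex R r,
    forall i, val y ord0 i = \sum_(j | theta j == i) val x ord0 j.
Proof.
pose y := \row_i \sum_(j | theta j == i) val x ord0 j.
have Dy : @simplex R r y.
  split=> [i|]; first by rewrite mxE sumr_ge0// => j _; exact: simplex_ge0.
  rewrite -[RHS](simplex_sum1 x) (partition_big theta xpredT)//=.
  by apply: eq_bigr => i _; rewrite mxE.
by exists (SigSub (mem_set Dy)) => i; rewrite /= mxE.
Qed.

Lemma real_point_glue s r (theta : 'I_s.+1 -> 'I_r.+1) (u : nerve T s)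
    (t : nerve T r) (x : @simplex R s) (y : @simplex R r) :
  (forall i j : 'I_s.+1, (i <= j)%N -> (theta i <= theta j)%N) ->
  (forall j, val u j = val t (theta j)) ->
  (forall i, val y ord0 i = \sum_(j | theta j == i) val x ord0 j) ->
  real_point u x = real_point t y.
Proof.
move=> mono ut yx; apply/eqmodP/asboolP; apply: rst_step.
exact: (Glue (theta := theta)).
Qed.

Lemma mk_nerve r (f : 'I_r.+1 -> T) :
  (forall i j : 'I_r.+1, (i <= j)%N -> (f i <= f j)%O) ->
  exists t : nerve T r, forall i, val t i = f i.
Proof.
move=> mono; have ch : is_chain (finfun f).
  by apply/'forall_'forall_implyP => i j ij; rewrite !ffunE; exact: mono.
by exists (exist (fun t : {ffun 'I_r.+1 -> T} => is_chain t) _ ch) => i;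
  rewrite /= ffunE.
Qed.

Lemma real_point_suppP z : exists r (t : nerve T r) (x : @simplex R r),
  z = real_point t x /\ forall i, supp z (val t i).
Proof.
have [r [t [x ->]]] := real_pointP z.
have [i0 xi0] : exists i0, 0 < val x ord0 i0.
  apply: contrapT => nox; have := simplex_sum1 x; rewrite big1.
    by move/esym/eqP; rewrite oner_eq0.
  move=> i _; apply/eqP; rewrite eq_le simplex_ge0 andbT leNgt.
  by apply/negP => xi; apply: nox; exists i.
pose i1 := [arg min_(i < i0 | 0 < val x ord0 i) (i : nat)].
have [xi1 i1_min] : 0 < val x ord0 i1 /\
    forall j, 0 < val x ord0 j -> (i1 <= j)%N.
  by rewrite /i1; case: arg_minnP.
(* [theta i] is the last index of positive weight up to [i], or the first such index [i1] if none
   comes before. It is monotone and fixes all indices of positive weight, so it pushes [x] to [x]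
   while its values avoid the vertices of weight zero. *)
pose P (i j : 'I_r.+1) := (0 < val x ord0 j) && (j <= maxn i i1)%N.
pose theta i := [arg max_(j > i1 | P i j) (j : nat)].
have thetaP i : P i (theta i) /\ forall j, P i j -> (j <= theta i)%N.
  by rewrite /theta; case: arg_maxnP => //; rewrite /P xi1 leq_maxr.
have theta_mono (i j : 'I_r.+1) : (i <= j)%N -> (theta i <= theta j)%N.
  move=> ij; apply: (thetaP j).2; have [/andP[xi ti] _] := thetaP i.
  rewrite /P xi (leq_trans ti)// geq_max leq_maxr andbT.
  by rewrite (leq_trans ij)// leq_maxl.
have theta_id i : 0 < val x ord0 i -> theta i = i.
  move=> xi; apply/val_inj/eqP; rewrite eqn_leq (thetaP i).2 ?andbT; last first.
    by rewrite /P xi leq_maxl.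
  have [/andP[_]] := thetaP i; suff /maxn_idPl -> : (i1 <= i)%N by [].
  exact: i1_min.
have [u Du] := @mk_nerve r (fun i => val t (theta i))
  (fun i j ij => nerve_mono t (theta_mono i j ij)).
exists r, u, x; split; last first.
  move=> i; apply/supp_real_pointP; exists (theta i); last by rewrite Du.
  by have [/andP[]] := thetaP i.
apply/esym/(real_point_glue (theta := theta)) => // i.
have [xi|] := ltP 0 (val x ord0 i); last first.
  move=> xi; have x0 : val x ord0 i = 0.
    by apply/eqP; rewrite eq_le xi simplex_ge0.
  rewrite x0 big1// => j /eqP tj; apply/eqP; rewrite eq_le simplex_ge0 andbT.
  rewrite leNgt; apply/negP => xj; move: (xj); rewrite -(theta_id j xj) tj x0.
  by rewrite ltxx.
rewrite (bigD1 i) ?theta_id//= big1 ?addr0// => j /andP[/eqP tj nij].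
apply/eqP; rewrite eq_le simplex_ge0 andbT leNgt; apply/negP => xj.
by rewrite -tj theta_id// eqxx in nij.
Qed.

(** Every chain through the support carries [z]. When a vertex is repeated, its whole weight goes to
    the first occurrence, so the coordinates depend only on the barycentric coordinates of [z]; this
    is what [realization_ext] needs. *)
Lemma real_point_along z r (t : nerve T r) :
  (forall a, supp z a -> exists i, val t i = a) ->
  exists y : @simplex R r, z = real_point t y /\
    forall i, val y ord0 i =
      if [forall j : 'I_r.+1, (j < i)%N ==> (val t j != val t i)]
      then lin (fun b => (b == val t i)%:R) z else 0.
Proof.
have [s [u [x [-> uz]]]] := real_point_suppP z => tz.
have ex j : exists i, val t i == val u j.
  by have [i <-] := tz _ (uz j); exists i.
pose theta j := [arg min_(i < xchoose (ex j) | val t i == val u j) (i : nat)].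
have thetaP j : val t (theta j) = val u j /\
    forall i, val t i = val u j -> (theta j <= i)%N.
  rewrite /theta; case: arg_minnP => [|i /eqP ? i_min];
    first exact: (xchooseP (ex j)).
  by split=> // k /eqP; exact: i_min.
have mono (i j : 'I_s.+1) : (i <= j)%N -> (theta i <= theta j)%N.
  move=> ij; rewrite leqNgt; apply/negP => ji.
  have := nerve_mono t (ltnW ji).
  rewrite !(thetaP _).1 => uji; have uij := nerve_mono u ij.
  have uE : val u i = val u j by apply/eqP; rewrite eq_le uij uji.
  suff: (theta i <= theta j)%N by rewrite leqNgt ji.
  by apply: (thetaP i).2; rewrite (thetaP j).1.
have [y Dy] := simplex_push theta x.
exists y; split.
  by apply: (real_point_glue (theta := theta)) => // j; rewrite (thetaP j).1.
move=> i; rewrite Dy; case: ifPn => [/forallP i_min|].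
  rewrite linE [RHS](bigID (fun j => theta j == i))/= [X in _ = _ + X]big1.
    rewrite addr0; apply: eq_bigr => j /eqP ji.
    by rewrite -(thetaP j).1 ji eqxx mulr1.
  move=> j ji; case: eqP => [tu|_]; last by rewrite mulr0.
  have := i_min (theta j); rewrite (thetaP j).1 tu eqxx implybF -leqNgt.
  move=> ij; case/eqP: ji; apply/val_inj/eqP; rewrite eqn_leq ij.
  by rewrite (thetaP j).2.
move=> /forallPn[k]; rewrite negb_imply negbK => /andP[ki /eqP tki].
apply: big_pred0 => j; apply/negP => /eqP ji.
have [tj tmin] := thetaP j; have := tmin k.
by rewrite tki -ji tj leqNgt ji ki => /(_ erefl).
Qed.

Lemma realization_ext z z' :
  (forall a, lin (fun b => (b == a)%:R) z = lin (fun b => (b == a)%:R) z') ->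
  z = z'.
Proof.
move=> zz'; have [r [t [x [zE tz]]]] := real_point_suppP z.
have tt a : supp z a -> exists i, val t i = a.
  by rewrite zE => /supp_real_pointP[i _ <-]; exists i.
have [y [zy yE]] := real_point_along tt.
have [|y' [zy' y'E]] := @real_point_along z' _ t.
  by move=> a; rewrite /supp /= -zz'; exact: tt.
rewrite [LHS]zy [RHS]zy'; congr real_point; apply/val_inj/rowP => i.
by rewrite yE y'E zz'.
Qed.

Lemma subrealizationP (S : set T) z :
  subrealization S z <-> supp z `<=` S.
Proof.
split=> [[r [t [x [tS ->]]]] a /supp_real_pointP[i _ <-]//|zS].
have [r [t [x [zE tz]]]] := real_point_suppP z.
by exists r, t, x; split=> // i; exact/zS/tz.
Qed.

Lemma lin_ge0 h z : (forall a, supp z a -> 0 <= h a) -> 0 <= lin h z.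
Proof.
have [r [t [x [-> tz]]]] := real_point_suppP z => h0.
by rewrite linE sumr_ge0// => i _; rewrite mulr_ge0 ?simplex_ge0// h0.
Qed.

Lemma linD h h' z : lin (fun a => h a + h' a) z = lin h z + lin h' z.
Proof.
by rewrite -big_split; apply: eq_bigr => i _; rewrite mulrDr.
Qed.

Lemma linZ c h z : lin (fun a => c * h a) z = c * lin h z.
Proof.
by rewrite [RHS]mulr_sumr; apply: eq_bigr => i _; rewrite mulrCA.
Qed.

Lemma linB h h' z : lin (fun a => h a - h' a) z = lin h z - lin h' z.
Proof.
by rewrite -mulN1r -linZ -linD; congr lin; apply/funext => a; rewrite mulN1r.
Qed.

Lemma lin_cst c z : lin (fun=> c) z = c.
Proof.
have [r [t [x ->]]] := real_pointP z.
by rewrite linE -mulr_suml simplex_sum1 mul1r.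
Qed.

Lemma ler_lin h h' z : (forall a, supp z a -> h a <= h' a) ->
  lin h z <= lin h' z.
Proof.
by move=> hh'; rewrite -subr_ge0 -linB lin_ge0// => a za; rewrite subr_ge0 hh'.
Qed.

Lemma eq_lin h h' z : (forall a, supp z a -> h a = h' a) ->
  lin h z = lin h' z.
Proof.
move=> hh'; apply/eqP; rewrite eq_le.
by apply/andP; split; apply: ler_lin => a /hh' ->.
Qed.

Lemma lin_eq0 h z : (forall a, supp z a -> h a = 0) -> lin h z = 0.
Proof. by move=> h0; rewrite -(lin_cst 0 z); exact: eq_lin. Qed.

Lemma supp_chain z a b : supp z a -> supp z b -> (a <= b)%O \/ (b <= a)%O.
Proof.
have [r [t [x ->]]] := real_pointP z.
move=> /supp_real_pointP[i _ <-] /supp_real_pointP[j _ <-].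
by have [ij|/ltnW ji] := leqP i j; [left|right]; apply: nerve_mono.
Qed.

Lemma supp_least (P : T -> Prop) z : (exists2 a, supp z a & P a) ->
  exists2 a, supp z a /\ P a & forall b, supp z b -> P b -> (a <= b)%O.
Proof.
have [r [t [x [zE tz]]]] := real_point_suppP z.
move=> [a]; rewrite {1}zE => /supp_real_pointP[i _ <-] Pi.
have Pi' : `[< P (val t i) >] by apply/asboolP.
case: (@arg_minnP _ i (fun j => `[< P (val t j) >]) (fun j =>
  j : nat) Pi') => k /asboolP Pk k_min.
exists (val t k) => // b; rewrite zE => /supp_real_pointP[j _ <-] Pj.
by apply/nerve_mono/k_min/asboolP.
Qed.

Lemma supp_greatest (P : T -> Prop) z : (exists2 a, supp z a & P a) ->
  exists2 a, supp z a /\ P a & forall b, supp z b -> P b -> (b <= a)%O.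
Proof.
have [r [t [x [zE tz]]]] := real_point_suppP z.
move=> [a]; rewrite {1}zE => /supp_real_pointP[i _ <-] Pi.
have Pi' : `[< P (val t i) >] by apply/asboolP.
case: (@arg_maxnP _ i (fun j => `[< P (val t j) >]) (fun j =>
  j : nat) Pi') => k /asboolP Pk k_max.
exists (val t k) => // b; rewrite zE => /supp_real_pointP[j _ <-] Pj.
by apply/nerve_mono/k_max/asboolP.
Qed.

Lemma supp_nonempty z : exists a, supp z a.
Proof.
have [r [t [x [_ tz]]]] := real_point_suppP z.
by exists (val t ord0).
Qed.

Lemma supp_bottom z : exists2 a, supp z a & forall b, supp z b -> (a <= b)%O.
Proof.
have [a0 za0] := supp_nonempty z.
have [|a [za _] a_min] := @supp_least (fun=> True) z; first by exists a0.
by exists a => // b zb; exact: a_min.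
Qed.

Lemma supp_top z : exists2 a, supp z a & forall b, supp z b -> (b <= a)%O.
Proof.
have [a0 za0] := supp_nonempty z.
have [|a [za _] a_max] := @supp_greatest (fun=> True) z; first by exists a0.
by exists a => // b zb; exact: a_max.
Qed.

Lemma lin_gt0 h z a : (forall b, supp z b -> 0 <= h b) -> supp z a -> 0 < h a ->
  0 < lin h z.
Proof.
move=> h0 za ha; apply: (@lt_le_trans _ _ (lin (fun b => h a * (b == a)%:R) z)).
  by rewrite linZ mulr_gt0.
apply: ler_lin => b zb; case: eqP => [->|_]; first by rewrite mulr1.
by rewrite mulr0 h0.
Qed.

Lemma suppNE z a : ~ supp z a -> lin (fun b => (b == a)%:R) z = 0.
Proof.
move=> nza; apply/eqP; rewrite eq_le lin_ge0 ?andbT// leNgt.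
exact/negP.
Qed.

(** The subspace is cut out by the vanishing of the barycentric coordinates outside [S]. *)
Lemma closed_subrealization (S : set T) :
  closed (subrealization S : set (realization R T)).
Proof.
rewrite (_ : subrealization S =
  \bigcap_(a in ~` S) (lin (fun b => (b == a)%:R) @^-1` [set 0])).
  apply: closed_bigI => a _; apply: preimage_closed; last exact: closed_eq.
  by move=> z _; exact: continuous_lin.
apply/seteqP; split=> z.
  by move=> /subrealizationP zS a nSa; apply/suppNE => /zS.
move=> z0; apply/subrealizationP => a; apply: contraPP => nSa.
by rewrite /supp /= z0// ltxx.
Qed.

Lemma continuous_real_point r (t : nerve T r) :
  continuous (@real_point R _ T r t).
Proof.
move=> x; have := @continuous_comp _ _ _
  (existT (fun t : simplices T => @simplex R (tag t) : Type) (existT (nerve T)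
    r t))
  (\pi_(quotient_topology {eq_quot (@glued_equiv R disp T)})) x.
apply; first exact: existT_continuous.
exact: pi_continuous.
Qed.

Lemma compact_simplex r : compact (@simplex R r).
Proof.
have cC := @rV_compact R r.+1 (fun=> `[0%R, 1%R]%classic)
  (fun=> @segment_compact R 0 1).
apply: subclosed_compact cC _.
  rewrite (_ : @simplex R r = \bigcap_(i in [set: 'I_r.+1])
      ((fun v : 'rV[R]_r.+1 => v ord0 i) @^-1` [set x | 0 <= x]) `&`
      (fun v : 'rV[R]_r.+1 => \sum_i v ord0 i) @^-1` [set 1]); last first.
    by apply/seteqP; split=> v [v0 v1]; split=> // i; [move=> _|]; exact: v0.
  apply: closedI.
    apply: closed_bigI => i _; apply: preimage_closed; last exact: closed_ge.
    by move=> v _; exact: coord_continuous.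
  apply: preimage_closed; last exact: closed_eq.
  move=> v _; apply: continuous_sum => i _; exact: coord_continuous.
move=> v [v0 v1] i /=; rewrite in_itv/= v0/= -v1 (bigD1 i)//=.
by rewrite lerDl sumr_ge0.
Qed.

(** Finitely many simplices of one dimension suffice: the support of a point, sorted and padded by
    repeating its top, is a chain of length [N.+1] in [s]. Each [K t] is the image of a compact
    simplex, or empty if [t] is not a chain. *)
Lemma compact_subrealization (S : set T) (s : seq T) :
  (forall a, S a -> a \in s) ->
  compact (subrealization S : set (realization R T)).
Proof.
move=> Ss; pose N := size s.
pose K (t : {ffun 'I_N.+1 -> seq_sub s}) := [set z : realization R T |
  exists u : nerve T N, (forall i, val u i = val (t i)) /\
  exists x, z = real_point u x].
apply: (@subclosed_compact _ _ (\big[setU/set0]_t K t)).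
- exact: closed_subrealization.
- apply: bigsetU_compact => t _.
  have [[u ut]|nou] := pselect (exists u : nerve T N,
      forall i, val u i = val (t i)); last first.
    rewrite (_ : K t = set0); first exact: compact0.
    by apply/seteqP; split=> // z [u [ut _]]; apply: nou; exists u.
  rewrite (_ : K t = @real_point R _ T _ u @` setT).
    apply: continuous_compact; last exact/compact_set_type/compact_simplex.
    exact/continuous_subspaceT/continuous_real_point.
  apply/seteqP; split=> z [].
    move=> v [vt [x ->]]; exists x => //; congr (real_point _ x).
    by apply/val_inj/ffunP => i; rewrite vt ut.
  by move=> x _ <-; exists u; split=> //; exists x.
move=> z /subrealizationP zS.
pose c := sort <=%O [seq a <- undup s | `[< supp z a >]].
have mem_c a : (a \in c) = `[< supp z a >].
  rewrite mem_sort mem_filter mem_undup andbC.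
  by case: asboolP => [/zS/Ss ->|]; rewrite ?andbF.
have c_sorted : sorted <=%O c.
  apply: (@sort_sorted_in _ (fun a => `[< supp z a >])).
    by move=> a b /asboolP za /asboolP zb; have [->|->] := supp_chain za zb;
      rewrite ?orbT.
  by apply/allP => a; rewrite mem_filter => /andP[].
have size_c : (size c <= N)%N.
  rewrite size_sort size_filter (leq_trans (count_size _ _))//.
  exact: size_undup.
have [a0 za0] := supp_nonempty z.
have c_gt0 : (0 < size c)%N.
  by have : a0 \in c by [rewrite mem_c; apply/asboolP]; case: (c).
pose f i := nth a0 c (minn i (size c).-1).
have fc i : f i \in c by rewrite mem_nth// -(prednK c_gt0) ltnS geq_minr.
have [i j ij|u uf] := @mk_nerve N (fun i => f i).
  rewrite /f; set k := minn i _; set l := minn j _.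
  have kl : (k <= l)%N.
    by rewrite leq_min geq_minr andbT (leq_trans (geq_minl _ _)).
  apply: (sorted_leq_nth le_trans le_refl) => //; rewrite inE.
    by rewrite /k -{2}(prednK c_gt0) ltnS geq_minr.
  by rewrite /l -{2}(prednK c_gt0) ltnS geq_minr.
have fs i : f i \in s.
  by apply/Ss/zS/asboolP; rewrite -mem_c.
have [|y [zE _]] := @real_point_along z _ u.
  move=> a /asboolP; rewrite -mem_c => ca.
  have ia : (index a c < N.+1)%N.
    by rewrite ltnS (leq_trans _ size_c)// index_size.
  exists (Ordinal ia); rewrite uf /f /=.
  rewrite (minn_idPl _) ?nth_index//.
  by rewrite -ltnS prednK// index_mem.
rewrite (bigD1 [ffun i : 'I_N.+1 => SeqSub (fs i)])//=; left.
exists u; split; first by move=> i; rewrite ffunE uf.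
by exists y.
Qed.

Definition vertex_simplex : @simplex R 0.
Proof.
exists (const_mx 1); apply/mem_set; split=> [i|]; first by rewrite mxE ler01.
by rewrite big_ord1 mxE.
Defined.

Lemma vertexP a : exists z : realization R T,
  forall b, supp z b <-> b = a.
Proof.
have [t ta] := @mk_nerve 0 (fun=> a) (fun _ _ _ => le_refl a).
exists (real_point t vertex_simplex) => b; split.
  by move=> /supp_real_pointP[i _ <-]; rewrite ta.
by move=> ->; apply/supp_real_pointP; exists ord0; rewrite ?ta// mxE ltr01.
Qed.

End NerveTheory.

(** * Configurations as polynomials *)

Section CellPolynomials.
Variables (R : realType) (n : nat) (L : eqType) (lam : 'I_n -> L).
Implicit Types (z : 'I_n -> R[i]) (p k : 'I_n) (l : L).

Definition cell_seq l := [seq k <- enum 'I_n | lam k == l].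

Definition rank p := index p (cell_seq (lam p)).

Definition cell_poly z l :=
  \prod_(r <- [seq z k | k <- cell_seq l]) ('X - r%:P).

(* Indexing the non-leading coefficients of all cell polynomials by the points
   themselves gives exactly [n] complex coordinates; that of [p] has degree
   [rank p + 1] in the roots. *)
Definition cell_coef z p : R[i] :=
  (cell_poly z (lam p))`_(size (cell_seq (lam p)) - (rank p).+1).

Lemma mem_cell_seq l k : (k \in cell_seq l) = (lam k == l).
Proof. by rewrite mem_filter mem_enum andbT. Qed.

Lemma cell_seq_uniq l : uniq (cell_seq l).
Proof. by rewrite filter_uniq// enum_uniq. Qed.

Lemma rank_lt p : (rank p < size (cell_seq (lam p)))%N.
Proof. by rewrite index_mem mem_cell_seq. Qed.

Lemma rank_ltn p : (rank p < n)%N.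
Proof.
apply: leq_trans (rank_lt p) _; rewrite size_filter.
by rewrite (leq_trans (count_size _ _))// size_enum_ord.
Qed.

(** The polynomials are monic of known degree, and the points of a cell enumerate all the other
    coefficients. *)
Lemma cell_poly_eq z z' : (forall p, cell_coef z p = cell_coef z' p) ->
  forall l, cell_poly z l = cell_poly z' l.
Proof.
move=> zz' l; apply/polyP => j; set m := size (cell_seq l).
have size_P y : size (cell_poly y l) = m.+1.
  by rewrite size_prod_XsubC size_map.
have [jm|mj] := ltnP j m; last first.
  move: mj; rewrite leq_eqVlt => /predU1P[<-|mj]; last first.
    by rewrite !nth_default ?size_P.
  have lcE y : (cell_poly y l)`_m = 1.
    by rewrite -[RHS](lead_coef_prod_XsubC [seq y k | k <- cell_seq l] xpredT
      id) lead_coefE size_P.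
  by rewrite !lcE.
have jm' : (m - j.+1 < m)%N by lia.
have [k0 _] : exists k0 : 'I_n, true.
  by move: jm' => {jm}; rewrite /m; case: (cell_seq l) => // k0 *; exists k0.
pose p := nth k0 (cell_seq l) (m - j.+1).
have pl : lam p = l by apply/eqP; rewrite -mem_cell_seq mem_nth.
have rp : rank p = (m - j.+1)%N by rewrite /rank pl index_uniq// cell_seq_uniq.
have := zz' p; rewrite /cell_coef pl rp.
by rewrite (_ : (_ - _)%N = j)//; rewrite -/m; lia.
Qed.

Lemma sum_eq_cell_seq z l c :
  (\sum_k ((lam k, z k) == (l, c)) =
     count_mem c [seq z k | k <- cell_seq l])%N.
Proof.
rewrite count_map count_filter -sum1_count big_enum_cond [RHS]big_mkcond.
by apply: eq_bigr => k _; rewrite xpair_eqE /= andbC; case: (_ && _).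
Qed.

(** A product of linear factors determines its roots with multiplicities; counting pairs of label
    and root yields one permutation for all cells at once. *)
Lemma cell_coef_inj z z' : (forall p, cell_coef z p = cell_coef z' p) ->
  exists s : 'S_n, (forall k, lam k = lam (s k)) /\ (forall k, z' k = z (s k)).
Proof.
move=> /cell_poly_eq zz'.
have [[l c]|s Es] := @perm_of_count _ _
    (fun k => (lam k, z k)) (fun k => (lam k, z' k)).
  by rewrite !sum_eq_cell_seq; apply/seq.permP/prod_XsubC_eq/zz'.
by exists s; split=> k; have [] := Es k.
Qed.

Lemma cell_coef_perm z (s : 'S_n) : (forall k, lam k = lam (s k)) ->
  forall p, cell_coef (z \o s) p = cell_coef z p.
Proof.
move=> ls p; rewrite /cell_coef; suff -> : cell_poly (z \o s) (lam p) =
  cell_poly z (lam p) by [].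
rewrite /cell_poly; apply: perm_big; apply/allP => c _ /=; apply/eqP.
rewrite -!sum_eq_cell_seq [RHS](reindex_inj (@perm_inj _ s)).
by apply: eq_bigr => k _; rewrite -ls.
Qed.

Lemma cell_coef_surj (v : 'I_n -> R[i]) :
  exists z, forall p, cell_coef z p = v p.
Proof.
have ex l : exists rs : seq R[i], size rs = size (cell_seq l) /\
    forall p, lam p = l ->
      (\prod_(r <- rs) ('X - r%:P))`_(size (cell_seq l) - (rank p).+1) = v p.
  set m := size (cell_seq l).
  (* Coefficients of the monic polynomial to be split: the value prescribed at the point of rank [r]
     belongs in degree [m - r.+1]. *)
  pose a j := if (j == m)%N then 1 else
    nth 0 [seq v k | k <- cell_seq l] (m - j.+1).
  pose P := \poly_(j < m.+1) a j.
  have am : a m = 1 by rewrite /a eqxx.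
  have sP : size P = m.+1 by rewrite size_poly_eq// am oner_neq0.
  have lP : lead_coef P = 1 by rewrite lead_coefE sP coef_poly ltnSn am.
  have [rs] := closed_field_poly_normal P; rewrite lP scale1r => PE.
  exists rs; split.
    by apply/eqP; rewrite -eqSS -(size_prod_XsubC rs id) -PE sP.
  move=> p pl; rewrite -PE coef_poly.
  have rm : (rank p < m)%N by have := rank_lt p; rewrite pl.
  rewrite ifT; last by lia.
  rewrite /a ifF; last by apply/negbTE; lia.
  rewrite (_ : (m - _)%N = rank p); last by lia.
  by rewrite (nth_map p)// /rank pl nth_index// mem_cell_seq pl.
have [rs rsP] := choice ex.
pose z p := nth 0 (rs (lam p)) (rank p).
have zrs l : [seq z k | k <- cell_seq l] = rs l.
  have [srs _] := rsP l.
  apply: (@eq_from_nth _ 0); first by rewrite size_map srs.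
  move=> j; rewrite size_map => jm.
  have [k0 _] : exists k0 : 'I_n, true.
    by move: jm; case: (cell_seq l) => // k0 *; exists k0.
  rewrite (nth_map k0)// /z.
  have kl : lam (nth k0 (cell_seq l) j) = l.
    by apply/eqP; rewrite -mem_cell_seq mem_nth.
  by rewrite /rank kl index_uniq// cell_seq_uniq.
exists z => p; rewrite /cell_coef /cell_poly zrs.
by have [_ ->] := rsP (lam p).
Qed.

(** By Vieta the coefficient is, up to sign, an elementary symmetric polynomial in the roots, hence
    homogeneous. *)
Lemma cell_coefZ (t : R[i]) z p :
  cell_coef (fun k => t * z k) p = t ^+ (rank p).+1 * cell_coef z p.
Proof.
have le1 := rank_lt p.
rewrite /cell_coef /cell_poly !coef_prod_XsubC ?size_map ?leq_subr//.
rewrite [RHS]mulrCA; congr (_ * _); rewrite big_distrr /=.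
apply: eq_bigr => I /eqP cI.
rewrite (_ : (rank p).+1 = #|I|); last by rewrite cI; lia.
rewrite -prodr_const -big_split /=; apply: eq_bigr => i _.
have ilt : (i < size (cell_seq (lam p)))%N by exact: ltn_ord.
by rewrite !(nth_map p).
Qed.

Lemma cell_coef_rank0 z p : rank p = 0%N ->
  cell_coef z p = - \sum_(k <- cell_seq (lam p)) z k.
Proof.
move=> r0; have := rank_lt p; rewrite r0 => m0.
rewrite /cell_coef r0 /cell_poly subn1 -(size_map z).
by rewrite coefPn_prod_XsubC ?size_map -?lt0n// big_map.
Qed.

End CellPolynomials.

Section ComplexContinuity.
Variables (R : realType) (X : topologicalType).

Definition complex_cont (h : X -> R[i]) : Prop :=
  continuous (fun x => complex.Re (h x)) /\ continuous (fun x =>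
    complex.Im (h x)).

Lemma complex_cont_cst c : complex_cont (fun=> c).
Proof. by split=> x; exact: cst_continuous. Qed.

Lemma ReM (a b : R[i]) : complex.Re (a * b) =
  complex.Re a * complex.Re b - complex.Im a * complex.Im b.
Proof. by case: a b => ? ? []. Qed.

Lemma ImM (a b : R[i]) : complex.Im (a * b) =
  complex.Re a * complex.Im b + complex.Im a * complex.Re b.
Proof. by case: a b => ? ? []. Qed.

Lemma complex_contM h h' :
  complex_cont h -> complex_cont h' -> complex_cont (fun x => h x * h' x).
Proof.
move=> [r i] [r' i']; split=> x.
  under eq_fun do rewrite ReM.
  exact: (continuousB (continuousM (r x) (r' x)) (continuousM (i x) (i' x))).
under eq_fun do rewrite ImM.
exact: (continuousD (continuousM (r x) (i' x)) (continuousM (i x) (r' x))).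
Qed.

Lemma complex_contB h h' :
  complex_cont h -> complex_cont h' -> complex_cont (fun x => h x - h' x).
Proof.
move=> [r i] [r' i']; split=> x.
  under eq_fun do rewrite raddfB.
  exact: (continuousB (r x) (r' x)).
under eq_fun do rewrite raddfB.
exact: (continuousB (i x) (i' x)).
Qed.

Lemma complex_cont_coef_prod (I : Type) (s : seq I) (z : I -> X -> R[i]) j :
  (forall k, complex_cont (z k)) ->
  complex_cont (fun x => (\prod_(r <- [seq z k x | k <- s]) ('X - r%:P))`_j).
Proof.
move=> zc; elim: s j => [|k s IH] j.
  by under eq_fun do rewrite big_nil; exact: complex_cont_cst.
under eq_fun do rewrite big_cons mulrBl coefB coefCM coefXM.
apply: complex_contB; last exact: complex_contM.
by case: j => [|j] /=; [exact: complex_cont_cst|exact: IH].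
Qed.

End ComplexContinuity.

Section SignedPower.
Variable R : realType.

(* Signed powers turn coordinates of different weights into coordinates of the
  same
   weight without changing their signs. *)
Definition signed_pow (e : nat) (u : R) := u * `|u| ^+ e.-1.

Lemma signed_pow0 e : signed_pow e 0 = 0.
Proof. by rewrite /signed_pow mul0r. Qed.

Lemma signed_powZ e t u :
  (0 < e)%N -> 0 <= t -> signed_pow e (t * u) = t ^+ e * signed_pow e u.
Proof.
move=> e0 t0; rewrite /signed_pow normrM exprMn (ger0_norm t0) -[in RHS](prednK
  e0) exprS.
by rewrite -!mulrA; congr (_ * _); rewrite mulrCA.
Qed.

Lemma norm_signed_pow e u : (0 < e)%N -> `|signed_pow e u| = `|u| ^+ e.
Proof.
by move=> e0; rewrite normrM normrX normr_id -exprS prednK.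
Qed.

Lemma signed_pow_inj e : (0 < e)%N -> injective (signed_pow e).
Proof.
move=> e0 u v uv; have nuv : `|u| = `|v|.
  by apply: (pexpIrn e0); rewrite ?nnegrE// -!norm_signed_pow// uv.
have [u0|u0] := eqVneq `|u| 0.
  by move: nuv; rewrite u0 => /esym/eqP; rewrite normr_eq0 => /eqP ->;
    apply/eqP; rewrite -normr_eq0 u0.
by move: uv; rewrite /signed_pow -nuv; apply: mulIf; rewrite expf_neq0.
Qed.

Lemma signed_pow_surj e w : (0 < e)%N -> exists u, signed_pow e u = w.
Proof.
move=> e0; pose a := `|w| `^ (e%:R^-1).
have ae : a ^+ e = `|w|.
  rewrite /a -powR_mulrn ?powR_ge0// -powRrM mulVf ?powRr1//.
  by rewrite pnatr_eq0 -lt0n.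
exists (Num.sg w * a); have [->|w0] := eqVneq w 0.
  by rewrite sgr0 mul0r signed_pow0.
rewrite /signed_pow normrM normr_sg w0 mul1r (ger0_norm (powR_ge0 _ _)).
by rewrite -mulrA -exprS prednK// ae -numEsg.
Qed.

Lemma continuous_signed_pow e : continuous (signed_pow e).
Proof.
move=> u; apply: (@continuousM _ _ id (fun u => `|u| ^+ e.-1)) => //.
apply: (@continuous_comp _ _ _ (fun u : R => `|u|) (fun u => u ^+ e.-1)).
  exact: norm_continuous.
exact: exprn_continuous.
Qed.

End SignedPower.

(** * Charts for configurations modulo translations *)

Section FirstOfFibre.
Variables (n : nat) (h : 'I_n -> nat).

(** One marked point per row or column; it stands for a translation and marks the coordinate that
    the normalization kills. *)
Definition fibre_first (p : 'I_n) :=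
  [forall k : 'I_n, (k < p)%N ==> (h k != h p)].

Definition fibre_min p : 'I_n := [arg min_(k < p | h k == h p) (k : nat)].

Lemma fibre_min_fibre p : h (fibre_min p) = h p.
Proof. by rewrite /fibre_min; case: arg_minnP => //= k /eqP. Qed.

Lemma fibre_min_le p k : h k = h p -> (fibre_min p <= k)%N.
Proof. by rewrite /fibre_min; case: arg_minnP => //= l _ + /eqP; apply. Qed.

Lemma fibre_first_min p : fibre_first (fibre_min p).
Proof.
apply/forallP => k; apply/implyP; rewrite fibre_min_fibre => kp.
by apply/eqP => /fibre_min_le; rewrite leqNgt kp.
Qed.

Lemma fibre_first_le p k : fibre_first p -> h k = h p -> (p <= k)%N.
Proof.
move=> /forallP/(_ k) fp kp; rewrite leqNgt; apply/negP => kltp.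
by move: fp; rewrite kltp kp eqxx.
Qed.

Lemma fibre_min_first p : fibre_first p -> fibre_min p = p.
Proof.
move=> fp; apply/val_inj/eqP; rewrite eqn_leq fibre_min_le//=.
exact/fibre_first_le/fibre_min_fibre.
Qed.

Lemma eq_fibre_min p k : h k = h p -> fibre_min k = fibre_min p.
Proof.
move=> kp; apply/val_inj/eqP.
by rewrite eqn_leq !fibre_min_le// fibre_min_fibre.
Qed.

Lemma card_fibre_first P : (forall k, (h k < P)%N) ->
  (forall a, (a < P)%N -> exists k, h k = a) -> #|fibre_first| = P.
Proof.
move=> hP hs; rewrite -[RHS]card_ord.
rewrite -(@card_in_image _ _ (fun k => Ordinal (hP k)) fibre_first).
  apply: eq_card => a; rewrite [RHS]inE; apply/fintype.imageP.
  have [k hk] := hs a (ltn_ord a); exists (fibre_min k);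
    first exact: fibre_first_min.
  by apply/val_inj; rewrite /= fibre_min_fibre.
move=> p k fp fk [pk]; apply/val_inj/eqP.
by rewrite eqn_leq !fibre_first_le.
Qed.

End FirstOfFibre.

Section ConfigurationChart.
Variables (R : realType) (n : nat) (f g : 'I_n -> nat).
Implicit Types (x y u : 'I_n -> R).

Let lam k := (f k, g k).

(* Rows may be translated horizontally and columns vertically, independently. *)
Definition sim x y x' y' := exists (s : 'S_n) (a b : nat -> R),
  [/\ forall k, f k = f (s k), forall k, g k = g (s k),
      forall k, x' k = x (s k) + a (f k) & forall k, y' k = y (s k) + b (g k)].

(** A cell lies inside a single fibre of [h], so the first point of the fibre is also the first of
    its cell. Its coefficient is then minus the sum of the roots, which centering makes zero in the
    real or imaginary part. *)
Lemma rank_fibre_first (h : 'I_n -> nat) p :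
  (forall k, lam k = lam p -> h k = h p) ->
  fibre_first h p -> rank lam p = 0%N.
Proof.
move=> lh fp; rewrite /rank.
have : sorted ltn [seq val k | k <- cell_seq lam (lam p)].
  rewrite sorted_map; apply: sorted_filter; first by move=> i j k;
    exact: ltn_trans.
  by rewrite -sorted_map val_enum_ord iota_ltn_sorted.
have := mem_cell_seq lam (lam p) p; rewrite eqxx.
have := mem_cell_seq lam (lam p).
case: (cell_seq lam (lam p)) => [|k s]; first by rewrite in_nil.
move=> mem; rewrite inE => /orP[/eqP ->|ps]; first by rewrite /= eqxx.
rewrite /= (path_sortedE ltn_trans) => /andP[/allP kall _].
have kp := kall _ (map_f _ ps).
have : k \in k :: s by rewrite mem_head.
by rewrite mem => /eqP/lh/(fibre_first_le fp); rewrite leqNgt kp.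
Qed.

(* Translations are normalized so that one chosen cell of every row (column)
   has barycentre [0]; its coefficient of weight [1] then vanishes and is
   dropped. *)
Definition average (h : 'I_n -> nat) u p : R :=
  (\sum_(k <- cell_seq lam (lam (fibre_min h p))) u k) /
  (size (cell_seq lam (lam (fibre_min h p))))%:R.

Definition center h u p : R := u p - average h u p.

Lemma size_cell_neq0 p : (size (cell_seq lam (lam p)))%:R != 0 :> R.
Proof. by rewrite pnatr_eq0 -lt0n (leq_ltn_trans _ (rank_lt lam p)). Qed.

Lemma eq_average h u p k : h k = h p -> average h u k = average h u p.
Proof. by move=> kp; rewrite /average (eq_fibre_min kp). Qed.

Lemma center_sum0 h u p : (forall k, lam k = lam p -> h k = h p) ->
  fibre_first h p -> \sum_(k <- cell_seq lam (lam p)) center h u k = 0.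
Proof.
move=> lh fp; rewrite big_seq.
under eq_bigr => k.
  rewrite mem_cell_seq => /eqP/lh kp; rewrite /center (eq_average _ kp); over.
rewrite -big_seq sumrB big_const_seq count_predT iter_addr_0 -mulr_natr.
by rewrite /average (fibre_min_first fp) divfK ?subrr// size_cell_neq0.
Qed.

Lemma center_id h u : (forall k l, lam k = lam l -> h k = h l) ->
  (forall p, fibre_first h p -> \sum_(k <- cell_seq lam (lam p)) u k = 0) ->
  forall k, center h u k = u k.
Proof.
move=> lh u0 k; rewrite /center /average u0 ?mul0r ?subr0//.
exact: fibre_first_min.
Qed.

Lemma centerZ h t u k : center h (fun k => t * u k) k = t * center h u k.
Proof. by rewrite /center /average -mulr_sumr -mulrA -mulrBr. Qed.

Lemma center_translate h (a : nat -> R) u k :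
  (forall k l, lam k = lam l -> h k = h l) ->
  center h (fun k => u k + a (h k)) k = center h u k.
Proof.
move=> lh; rewrite /center /average big_split /=.
have -> : \sum_(l <- cell_seq lam (lam (fibre_min h k))) a (h l) =
    a (h k) * (size (cell_seq lam (lam (fibre_min h k))))%:R.
  rewrite big_seq (eq_bigr (fun=> a (h k))); last first.
    by move=> l; rewrite mem_cell_seq => /eqP/lh ->; rewrite fibre_min_fibre.
  by rewrite -big_seq big_const_seq count_predT iter_addr_0 mulr_natr.
rewrite mulrDl mulfK ?size_cell_neq0//; ring.
Qed.

Lemma center_perm h (s : 'S_n) u k : (forall k, lam k = lam (s k)) ->
  (forall k, h k = h (s k)) ->
  center h (u \o s) k = center h u (s k).
Proof.
move=> ls hs; rewrite /center (eq_average u (esym (hs k))); congr (_ - _ / _).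
rewrite !big_filter !big_enum_cond /= [RHS](reindex_inj (@perm_inj _ s)).
by apply: eq_bigl => l; rewrite -ls.
Qed.

Lemma center_diff h u :
  exists a : nat -> R, forall k, center h u k = u k + a (h k).
Proof.
exists (fun i => - xget 0 [set c | exists2 k, h k = i & average h u k = c]) =>
  k.
rewrite /center; congr (_ - _); case: xgetP => [c _ [l lk <-]|];
  first exact: eq_average.
by move/(_ (average h u k)); case; exists k.
Qed.

Definition centered x y k : R[i] := Complex (center f x k) (center g y k).

Definition kept_coords : {set 'I_n * bool} :=
  [set pb | ~~ fibre_first (if pb.2 then g else f) pb.1]%SET.

Lemma card_kept_coords p q : (forall k, (f k < p)%N) ->
  (forall a, (a < p)%N -> exists k, f k = a) -> (forall k, (g k < q)%N) ->
  (forall a, (a < q)%N -> exists k, g k = a) ->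
  #|kept_coords| = (2 * n - (p + q))%N.
Proof.
move=> fp fs gq gs; rewrite -(card_fibre_first fp fs) -(card_fibre_first gq gs).
have -> : (2 * n = #|{: 'I_n * bool}|)%N by rewrite card_prod card_ord
  card_bool mulnC.
rewrite -(cardsC kept_coords) -[LHS](addnK #|~: kept_coords|).
congr (_ - _)%N; rewrite -!sum1_card.
rewrite (eq_bigl (fun pb : 'I_n * bool => fibre_first (if pb.2 then g else f)
  pb.1)); last first.
  by move=> pb; rewrite !inE negbK.
rewrite big_mkcond /= (eq_bigr (fun pb : 'I_n * bool => (fun p b =>
  if fibre_first (if b then g else f) p then 1 else 0)%N pb.1 pb.2)) //.
rewrite -(pair_bigA _ (fun p b => if fibre_first (if b then g else f) p then 1
  else 0)%N) /=.
under eq_bigr do rewrite big_bool.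
rewrite big_split /= addnC; congr (_ + _)%N; rewrite [RHS]big_mkcond;
  by [].
Qed.

(** The coefficient at a point has weight [rank + 1], which is at most [n] and so divides n!. The
    complementary signed power brings every coordinate to the common weight n!. *)
Definition chart_coord x y (pb : 'I_n * bool) : R :=
  signed_pow (n`! %/ (rank lam pb.1).+1)
    ((if pb.2 then @complex.Im R else @complex.Re R)
       (cell_coef lam (centered x y) pb.1)).

Definition chart x y : 'rV[R]_#|kept_coords| :=
  \row_i chart_coord x y (enum_val i).

Lemma weight_gt0 p : (0 < n`! %/ (rank lam p).+1)%N.
Proof.
by rewrite divn_gt0// dvdn_leq ?fact_gt0// dvdn_fact// rank_ltn.
Qed.

Lemma chart_coord_dropped x y pb :
  pb \notin kept_coords -> chart_coord x y pb = 0.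
Proof.
rewrite inE negbK /chart_coord => fp.
rewrite (_ : (if _ then _ else _) _ = 0) ?signed_pow0//.
have r0 : rank lam pb.1 = 0%N.
  by apply: (rank_fibre_first _ fp) => k [fk gk]; case: ifP.
rewrite cell_coef_rank0//; case: pb {r0} fp => p [] /= fp.
  by rewrite raddfN raddf_sum /= center_sum0 ?oppr0// => k [].
by rewrite raddfN raddf_sum /= center_sum0 ?oppr0// => k [].
Qed.

Lemma chart_sim x y x' y' : sim x y x' y' -> chart x y = chart x' y'.
Proof.
move=> [s [a [b [fs gs xx' yy']]]]; apply/rowP => i; rewrite !mxE /chart_coord.
set p := (enum_val i).1; congr signed_pow.
have ls k : lam k = lam (s k) by rewrite /lam -fs -gs.
suff -> : centered x' y' = centered x y \o s by rewrite (cell_coef_perm _ ls).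
apply/funext => k; rewrite /centered /= -!center_perm//.
have -> : x' = fun k => (x \o s) k + a (f k) by apply/funext.
have -> : y' = fun k => (y \o s) k + b (g k) by apply/funext.
by rewrite !center_translate// => ? ? [].
Qed.

(** The dropped coordinates vanish on both sides, so all cell coefficients agree. The permutation of
    the roots and the differences of the normalizing translations make up the [sim]. *)
Lemma chart_inj x y x' y' : chart x y = chart x' y' -> sim x y x' y'.
Proof.
move=> E; have {}E pb : chart_coord x y pb = chart_coord x' y' pb.
  have [J|nJ] := boolP (pb \in kept_coords); last by rewrite
    !chart_coord_dropped.
  by have /rowP/(_ (enum_rank_in J pb)) := E; rewrite !mxE enum_rankK_in.
have {}E p : cell_coef lam (centered x y) p = cell_coef lam (centered x' y') p.
  apply/eqP; rewrite eq_complex; apply/andP.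
  have := E (p, true); have := E (p, false).
  by move=> /(signed_pow_inj (weight_gt0 _)) -> /(signed_pow_inj (weight_gt0
    _)) ->.
have [s [ls zs]] := cell_coef_inj E.
have [a ax] := center_diff f x; have [a' ax'] := center_diff f x'.
have [b bx] := center_diff g y; have [b' bx'] := center_diff g y'.
exists s, (fun i => a i - a' i), (fun i => b i - b' i).
have fs k : f k = f (s k) by have [] := ls k.
have gs k : g k = g (s k) by have [] := ls k.
split=> // k.
  have [+ _] := zs k; rewrite ax ax' -fs => H.
  by rewrite addrA -H addrK.
have [_] := zs k; rewrite bx bx' -gs => H.
by rewrite addrA -H addrK.
Qed.

Lemma chart_surj v : exists x y, chart x y = v.
Proof.
pose w pb : R := if pselect (pb \in kept_coords) is left J
  then v ord0 (enum_rank_in J pb) else 0.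
have [u uw] := choice (fun pb => signed_pow_surj (w pb) (weight_gt0 pb.1)).
have [z zu] := cell_coef_surj lam
  (fun p => Complex (u (p, false)) (u (p, true))).
have u0 pb : pb \notin kept_coords -> u pb = 0.
  move=> nJ; apply: (signed_pow_inj (weight_gt0 pb.1));
    rewrite uw signed_pow0 /w.
  by case: pselect => // J; rewrite J in nJ.
(* The dropped coordinates were prescribed to be zero, so the roots found are already normalized and
   centering does not move them. *)
have cx : forall k, center f (fun k => complex.Re (z k)) k = complex.Re (z k).
  apply: center_id => [? ? []//|p fp]; rewrite -raddf_sum.
  have r0 : rank lam p = 0%N by apply: (rank_fibre_first _ fp) => k [].
  have := cell_coef_rank0 z r0; rewrite zu => /(congr1 (@complex.Re R)) /=.
  rewrite u0 ?inE ?negbK// raddfN => /eqP; rewrite eq_sym oppr_eq0 => /eqP.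
  by [].
have cy : forall k, center g (fun k => complex.Im (z k)) k = complex.Im (z k).
  apply: center_id => [? ? []//|p fp]; rewrite -raddf_sum.
  have r0 : rank lam p = 0%N by apply: (rank_fibre_first _ fp) => k [].
  have := cell_coef_rank0 z r0; rewrite zu => /(congr1 (@complex.Im R)) /=.
  rewrite u0 ?inE ?negbK// raddfN => /eqP; rewrite eq_sym oppr_eq0 => /eqP.
  by [].
exists (fun k => complex.Re (z k)), (fun k => complex.Im (z k)).
have zE : centered (fun k => complex.Re (z k)) (fun k => complex.Im (z k)) = z.
  by apply/funext => k; rewrite /centered cx cy; case: (z k).
apply/rowP => i; rewrite mxE /chart_coord zE zu.
set pb := enum_val i.
have -> : (if pb.2 then @complex.Im R else @complex.Re R)
    (Complex (u (pb.1, false)) (u (pb.1, true))) = u pb.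
  by case: (pb) => p [].
rewrite uw /w; case: pselect => [J|]; last by case; exact: enum_valP.
by congr (v ord0 _); apply: enum_val_inj; rewrite enum_rankK_in.
Qed.

Lemma chartZ t x y : 0 <= t ->
  chart (fun k => t * x k) (fun k => t * y k) = t ^+ n`! *: chart x y.
Proof.
move=> t0; apply/rowP => i; rewrite !mxE /chart_coord; set pb := enum_val i.
have -> : centered (fun k => t * x k) (fun k => t * y k) =
    fun k => (t%:C)%C * centered x y k.
  apply/funext => k; rewrite /centered !centerZ.
  by apply/eqP; rewrite eq_complex ReM ImM /= !mul0r subr0 addr0 !eqxx.
rewrite cell_coefZ -rmorphXn /=.
have -> : (if pb.2 then @complex.Im R else @complex.Re R)
    (((t ^+ (rank lam pb.1).+1)%:C)%C * cell_coef lam (centered x y) pb.1) =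
  t ^+ (rank lam pb.1).+1 * (if pb.2 then @complex.Im R else @complex.Re R)
    (cell_coef lam (centered x y) pb.1).
  by case: pb.2; rewrite ?ReM ?ImM /= !mul0r ?subr0 ?addr0.
rewrite signed_powZ ?weight_gt0 ?exprn_ge0// -exprM; congr (_ ^+ _ * _).
by rewrite mulnC divnK// dvdn_fact// rank_ltn.
Qed.

Lemma chart00 : chart (fun=> 0) (fun=> 0) = 0.
Proof.
have := chartZ (fun=> 0) (fun=> 0) (lexx 0).
rewrite expr0n eqn0Ngt fact_gt0 /= scale0r => <-.
by congr chart; apply/funext => k; rewrite mul0r.
Qed.

Lemma continuous_center (X : topologicalType) h (x : 'I_n -> X -> R) k :
  (forall k, continuous (x k)) -> continuous (fun z => center h (fun k =>
    x k z) k).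
Proof.
move=> xc z; rewrite /center /average.
apply: (@continuousB _ _ _ (x k) (fun z => (\sum_(l <- _) x l z) / _));
  first exact: xc.
apply: (@continuousM _ _ (fun z => \sum_(l <- _) x l z) (fun=> _)).
  by apply: continuous_sum => l _; exact: xc.
exact: cst_continuous.
Qed.

Lemma continuous_chart_coord (X : topologicalType) (x y : 'I_n -> X -> R) pb :
  (forall k, continuous (x k)) -> (forall k, continuous (y k)) ->
  continuous (fun z => chart_coord (fun k => x k z) (fun k => y k z) pb).
Proof.
move=> xc yc z.
have cc k : complex_cont (fun z => centered (fun k => x k z) (fun k =>
  y k z) k).
  by split=> ?; apply: continuous_center.
have [re im] := complex_cont_coef_prod (cell_seq lam (lam pb.1))
  (size (cell_seq lam (lam pb.1)) - (rank lam pb.1).+1) cc.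
apply: continuous_comp; last exact: continuous_signed_pow.
by case: pb.2; [exact: im|exact: re].
Qed.

End ConfigurationChart.

(** * Points of a cell as configurations *)

Section Sim.
Variables (R : realType) (n : nat) (f g : 'I_n -> nat).
Implicit Types x y : 'I_n -> R.

Lemma sim_sym x y x' y' : sim f g x y x' y' -> sim f g x' y' x y.
Proof.
move=> [s [a [b [fs gs xx yy]]]]; exists s^-1%g, (fun i => - a i), (fun i =>
  - b i).
have fs' k : f k = f (s^-1%g k) by rewrite [RHS]fs permKV.
have gs' k : g k = g (s^-1%g k) by rewrite [RHS]gs permKV.
by split=> // k; [rewrite xx permKV -fs' addrK|rewrite yy permKV -gs' addrK].
Qed.

Lemma simZ c x y x' y' : sim f g x y x' y' ->
  sim f g (fun k => c * x k) (fun k => c * y k)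
    (fun k => c * x' k) (fun k => c * y' k).
Proof.
move=> [s [a [b [fs gs xx yy]]]].
exists s, (fun i => c * a i), (fun i => c * b i).
by split=> // k; rewrite ?xx ?yy mulrDr.
Qed.

Lemma fibre_translation (f' : 'I_n -> nat) (u : 'I_n -> R) :
  (forall k l, f' k = f' l -> u k = u l) -> exists a : nat ->
    R, forall k, u k = a (f' k).
Proof.
move=> uf; exists (fun i => xget 0 [set c | exists2 k,
  f' k = i & u k = c]) => k.
case: xgetP => [c _ [l lk <-]|]; first exact: uf.
by move/(_ (u k)); case; exists k.
Qed.

End Sim.

Section Sheets.
Variables (R : realType) (n : nat).
Implicit Types (z : stochastihedron R n) (N : CM n) (x y : 'I_n -> R).

Definition xpos z k := lin (fun N => (rho N k)%:R) z.
Definition ypos z k := lin (fun N => (kappa N k)%:R) z.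

Lemma cellFP M z : cellF R M z <-> forall N, supp z N -> (N <= M)%O.
Proof. exact: subrealizationP. Qed.

Lemma cellF'P M z : cellF' R M z <-> forall N, supp z N -> (N < M)%O.
Proof. exact: subrealizationP. Qed.

Variables (M : CM n) (f g : 'I_n -> nat).
Hypothesis Mfg : lab M f g.

(** Sheets that induce the fixed labels [f] and [g] on [M]: all points of the cell then use one
    naming of the rows and columns of [M]. *)
Definition good (s : 'S_n * 'S_n) : Prop :=
  (forall k, f k = rho M (s.1 k)) /\ (forall k, g k = kappa M (s.2 k)).

Definition onsheet z (s : 'S_n * 'S_n) : Prop :=
  forall N, supp z N -> sheet N s.

Lemma good_sheet s : good s -> sheet M s.
Proof.
move=> [fs gs]; rewrite /sheet.
suff [<- <-] : f = rho M \o s.1 /\ g = kappa M \o s.2 by [].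
by split; apply/funext.
Qed.

(** A sheet of the bottom of the chain is renamed by a permutation that carries its labels in [M] to
    [f] and [g]; it then passes up the chain. *)
Lemma exists_sheet z : cellF R M z -> exists2 s, good s & onsheet z s.
Proof.
move=> /cellFP zM; have [N0 zN0 N0min] := supp_bottom z.
have [s0 L0] := sheet_ex N0.
have [LM _ _] := sheet_le (zM _ zN0) L0.
have [t [ft gt]] := lab_perm LM Mfg.
have L : sheet N0 (t * s0.1, t * s0.2)%g.
  have := lab_comp_perm t L0; congr (lab N0 _ _); apply/funext => k;
    by rewrite /= permM.
exists (t * s0.1, t * s0.2)%g; first by split=> k; rewrite ?ft ?gt /= permM.
by move=> N zN; have [] := sheet_le (N0min _ zN) L.
Qed.

(** Some permutation of the points matches the labels of both sheets in the bottom matrix, hence in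
    every matrix above it, and therefore matches all coordinates with zero translations. *)
Lemma sheet_sim z s s' : cellF R M z -> good s -> good s' ->
  onsheet z s -> onsheet z s' ->
  sim f g (xpos z \o s.1) (ypos z \o s.2) (xpos z \o s'.1) (ypos z \o s'.2).
Proof.
move=> /cellFP zM gs gs' zs zs'; have [N0 zN0 N0min] := supp_bottom z.
have [t [rt kt]] := lab_perm (zs _ zN0) (zs' _ zN0).
have rE N k : (N0 <= N)%O -> rho N (s'.1 k) = rho N (s.1 (t k)).
  by move=> NN; apply/eqP; rewrite eqn_leq !(rho_le NN)//; have /= -> := rt k.
have kE N k : (N0 <= N)%O -> kappa N (s'.2 k) = kappa N (s.2 (t k)).
  by move=> NN; apply/eqP; rewrite eqn_leq !(kappa_le NN)//; have /= -> := kt k.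
have N0M := zM _ zN0.
exists t, (fun=> 0), (fun=> 0); split=> k.
- by rewrite gs'.1 gs.1 rE.
- by rewrite gs'.2 gs.2 kE.
- by rewrite addr0; apply: eq_lin => N zN; rewrite rE// N0min.
- by rewrite addr0; apply: eq_lin => N zN; rewrite kE// N0min.
Qed.

Definition separated x y N (u : R) : Prop :=
  exists h k : 'I_n -> nat, [/\ lab N h k,
    forall p q, (h p <= h q)%N -> (f p <= f q)%N,
    forall p q, (k p <= k q)%N -> (g p <= g q)%N,
    forall p q, f p = f q -> (h p < h q)%N -> u <= x q - x p &
    forall p q, g p = g q -> (k p < k q)%N -> u <= y q - y p].

Lemma separated_sim x y x' y' N u : sim f g x y x' y' ->
  separated x y N u -> separated x' y' N u.
Proof.
move=> [s [a [b [fs gs xx yy]]]] [h [k [L hf kg hx ky]]].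
exists (h \o s), (k \o s); split=> [|p q|p q|p q fpq|p q gpq] /=.
- exact: lab_comp_perm.
- by move=> /hf; rewrite -!fs.
- by move=> /kg; rewrite -!gs.
- by move=> /hx; rewrite -!fs => /(_ fpq); rewrite !xx fpq; lra.
- by move=> /ky; rewrite -!gs => /(_ gpq); rewrite !yy gpq; lra.
Qed.

Lemma separatedZ c x y N u : 0 < c -> separated x y N u ->
  separated (fun k => c * x k) (fun k => c * y k) N (c * u).
Proof.
move=> c0 [h [k [L hf kg hx ky]]]; exists h, k; split=> // p q pq hpq.
  by rewrite -mulrBr ler_pM2l// hx.
by rewrite -mulrBr ler_pM2l// ky.
Qed.

(** As [u] is positive, some member of the chain is [<= N], so its sheet is a sheet of [N]. Two
    positions that [N] separates are separated by all members [<= N], each adding at least its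
    weight to the difference. *)
Lemma cell_separated z s N u : cellF R M z -> good s -> onsheet z s ->
  (N <= M)%O -> 0 < u -> u <= lin (fun N' => (N' <= N)%O%:R) z ->
  separated (xpos z \o s.1) (ypos z \o s.2) N u.
Proof.
move=> /cellFP zM gs zs NM u0 uN.
have [N1 zN1 N1N] : exists2 N1, supp z N1 & (N1 <= N)%O.
  apply: contrapT => noN; move: uN; rewrite leNgt => /negP; apply.
  rewrite lin_eq0// => N' zN'.
  by case: (boolP (N' <= N)%O) => // N'N; case: noN; exists N'.
have [L _ _] := sheet_le N1N (zs _ zN1).
have key (r : CM n -> 'I_n -> nat) (k l : 'I_n) :
    (forall N N', (N <= N')%O -> forall k l, (r N k <= r N l)%N ->
      (r N' k <= r N' l)%N) ->
    (forall N' (k l : 'I_n), (k <= l)%N -> (r N' k <= r N' l)%N) ->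
    (r N k < r N l)%N -> u <= lin (fun N' => (r N' l)%:R) z - lin (fun N' =>
      (r N' k)%:R) z.
  move=> rle rm rkl; rewrite -linB; apply: le_trans uN _.
  have kl : (k <= l)%N.
    by rewrite leqNgt; apply/negP => /ltnW/(rm N); rewrite leqNgt rkl.
  apply: ler_lin => N' zN'; case: (boolP (N' <= N)%O) => N'N.
    rewrite lerBrDr -natrD ler_nat add1n ltnNge; apply/negP => /(rle _ _ N'N).
    by rewrite leqNgt rkl.
  by rewrite subr_ge0 ler_nat rm.
exists (rho N \o s.1), (kappa N \o s.2); split=> [//|p q|p q|p q _|p q _] /=.
- by rewrite !gs.1; exact: rho_le.
- by rewrite !gs.2; exact: kappa_le.
- exact: (key (@rho n) (s.1 p) (s.1 q) (@rho_le n) (@rho_mono n)).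
- exact: (key (@kappa n) (s.2 p) (s.2 q) (@kappa_le n) (@kappa_mono n)).
Qed.

(* Points with consecutive abscissas and the same label in [M'] are less than
   [u] apart, so a [u]-separated labelling cannot distinguish them. *)
Lemma separated_le z s N u M' : cellF R M z -> good s -> onsheet z s ->
  separated (xpos z \o s.1) (ypos z \o s.2) N u -> 0 < u ->
  (M' <= M)%O -> sheet M' s ->
  lin (fun N' => (~~ (M' <= N')%O)%:R) z < u -> (M' <= N)%O.
Proof.
move=> /cellFP zM gs zs [h [k [L hf kg hx ky]]] u0 M'M M's Mu.
have key (r : CM n -> 'I_n -> nat) (pi : 'S_n) (h' f' : 'I_n -> nat) :
    (forall N N', (N <= N')%O -> forall k l, (r N k <= r N l)%N ->
      (r N' k <= r N' l)%N) ->
    (forall N' (k l : 'I_n), (k <= l)%N -> (r N' k <= r N' l)%N) ->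
    (forall N' (k l : 'I_n), l = k.+1 :> nat -> (r N' l <= (r N' k).+1)%N) ->
    (forall k, f' k = r M (pi k)) ->
    (forall p q, (h' p <= h' q)%N -> (f' p <= f' q)%N) ->
    (forall p q, f' p = f' q -> (h' p < h' q)%N ->
       u <= lin (fun N' => (r N' (pi q))%:R) z - lin (fun N' =>
         (r N' (pi p))%:R) z) ->
    forall p q, (r M' (pi p) <= r M' (pi q))%N -> (h' p <= h' q)%N.
  move=> rle rm rs f'E hf' hx'.
  pose H i := h' (pi^-1%g i).
  have Hm (i j : 'I_n) : (i <= j)%N -> (H i <= H j)%N.
    move=> ij; rewrite leqNgt; apply/negP => Hji.
    have FE : f' (pi^-1%g j) = f' (pi^-1%g i).
      apply/eqP; rewrite eqn_leq hf'; last exact: ltnW.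
      by rewrite !f'E !permKV rm.
    have := hx' _ _ FE Hji; rewrite !permKV leNgt => /negP; apply.
    apply: le_lt_trans u0; rewrite subr_le0.
    by apply: ler_lin => N' _; rewrite ler_nat rm.
  have Hs (i j : 'I_n) : j = i.+1 :> nat -> r M' i = r M' j -> H i = H j.
    move=> ij rij; apply/eqP; rewrite eqn_leq Hm ?ij//= leqNgt.
    apply/negP => Hij.
    have FE : f' (pi^-1%g i) = f' (pi^-1%g j).
      by rewrite !f'E !permKV; apply/eqP; rewrite eqn_leq !(rle _ _ M'M)// rij.
    have := hx' _ _ FE Hij; rewrite !permKV leNgt => /negP; apply.
    apply: le_lt_trans Mu; rewrite -linB; apply: ler_lin => N' zN'.
    have [M'N'|_] := boolP (M' <= N')%O.
      suff -> : r N' i = r N' j by rewrite subrr.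
      by apply/eqP; rewrite eqn_leq !(rle _ _ M'N')// rij.
    by rewrite /= lerBlDl -natrD ler_nat addn1 rs.
  have Hc (i j : 'I_n) : (i <= j)%N -> r M' i = r M' j -> H i = H j.
    move=> ij; have [d] := ubnP (j - i); elim: d i ij => // d IH i ij dij rij.
    move: ij; rewrite leq_eqVlt => /predU1P[/val_inj ->//|ij].
    have i1n : (i.+1 < n)%N by rewrite (leq_ltn_trans ij).
    pose i1 := Ordinal i1n.
    have ri1 : r M' i = r M' i1.
      by apply/eqP; rewrite eqn_leq rm ?leqnSn//= rij rm.
    rewrite (Hs i i1)//; apply: IH => //; last by rewrite -ri1.
    by move: dij; rewrite /=; lia.
  move=> p q pq; rewrite -[p](permK pi) -[q](permK pi) -/(H _) -/(H _).
  have [/Hm//|qp] := leqP (pi p) (pi q).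
  by rewrite (Hc (pi q) (pi p)) ?(ltnW qp)//; apply/eqP;
    rewrite eqn_leq pq rm// ltnW.
apply: (lab_le M's L) => p q /=.
  exact: (key (@rho n) s.1 h f (@rho_le n) (@rho_mono n) (@rho_step n) gs.1 hf
    hx).
exact: (key (@kappa n) s.2 k g (@kappa_le n) (@kappa_mono n) (@kappa_step n)
  gs.2 kg ky).
Qed.

(* The largest gap of the configuration of [z] inside a row or column of [M]. *)
Definition depth z : R := 1 - lin (fun N => (N == M)%:R) z.

Lemma depthE z : depth z = lin (fun N => (N != M)%:R) z.
Proof.
rewrite /depth -[X in X - _](lin_cst 1 z) -linB; apply: eq_lin => N _.
by case: eqP => _; rewrite ?subrr ?subr0.
Qed.

Lemma depth_ge0 z : 0 <= depth z.
Proof. by rewrite depthE lin_ge0. Qed.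

Lemma depth_le1 z : depth z <= 1.
Proof. by rewrite /depth gerBl lin_ge0. Qed.

Lemma depth_eq0 z : depth z = 0 -> forall N, supp z N -> N = M.
Proof.
move=> d0 N zN; apply: contrapT => /eqP NM.
suff : 0 < depth z by rewrite d0 ltxx.
by rewrite depthE; apply: (lin_gt0 _ zN) => //; rewrite NM ltr01.
Qed.

Lemma depth_eq1 z : cellF R M z -> depth z = 1 <-> cellF' R M z.
Proof.
move=> /cellFP zM; split=> [d1|/cellF'P zM'].
  apply/cellF'P => N zN; rewrite lt_neqAle zM// andbT.
  apply/eqP => NM; move: zN; rewrite NM /supp /=.
  move: d1; rewrite /depth => /eqP; rewrite subr_eq addrC -subr_eq subrr =>
    /eqP <-.
  by rewrite ltxx.
rewrite depthE -[RHS](lin_cst 1 z); apply: eq_lin => N /zM'.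
by rewrite lt_neqAle => /andP[->].
Qed.

(** Here [M] itself plays the part of [M'] in [separated_le]: the weight of the members not above
    [M] is the depth. *)
Lemma separated_depth z s N u : cellF R M z -> good s -> onsheet z s ->
  separated (xpos z \o s.1) (ypos z \o s.2) N u -> 0 < u -> (N < M)%O ->
  u <= depth z.
Proof.
move=> zM gs zs S u0 NM; rewrite leNgt; apply/negP => du.
suff : (M <= N)%O by rewrite (lt_geF NM).
apply: (separated_le zM gs zs S u0) => //; first exact: good_sheet.
rewrite (_ : lin _ z = depth z)// depthE; apply: eq_lin => N' zN'.
by have /cellFP/(_ _ zN') N'M := zM; rewrite eq_le N'M.
Qed.

(** The greatest member other than [M] has below it all the weight off [M]. *)
Lemma depth_separated z s :
  cellF R M z -> good s -> onsheet z s -> 0 < depth z ->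
  exists2 N, (N < M)%O & separated (xpos z \o s.1) (ypos z \o s.2) N (depth z).
Proof.
move=> zF gs zs d0; have /cellFP zM := zF.
have [N1 [zN1 N1M] N1max] : exists2 N1, supp z N1 /\ N1 <> M &
    forall N, supp z N -> N <> M -> (N <= N1)%O.
  apply: supp_greatest; apply: contrapT => no.
  move: d0; rewrite depthE lin_eq0 ?ltxx// => N zN.
  by case: eqP => // NM; case: no; exists N.
have N1ltM : (N1 < M)%O by rewrite lt_neqAle zM// andbT; apply/eqP.
exists N1 => //; apply: cell_separated => //; first exact: ltW.
rewrite depthE; apply: ler_lin => N zN; case: eqP => //= NM.
by rewrite N1max.
Qed.

(** Separation passes from [z] to [z']. If [z'] had less weight on members [<= N], let [M'] be the
    least member of its chain not [<= N]: the members not above [M'] are then too light, and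
    [separated_le] gives [M' <= N], a contradiction. *)
Lemma sim_le_lin z z' s s' N :
  cellF R M z -> cellF R M z' -> good s -> good s' ->
  onsheet z s -> onsheet z' s' ->
  sim f g (xpos z \o s.1) (ypos z \o s.2) (xpos z' \o s'.1) (ypos z' \o s'.2) ->
  (N <= M)%O ->
  lin (fun N' => (N' <= N)%O%:R) z <= lin (fun N' => (N' <= N)%O%:R) z' :> R.
Proof.
move=> zF z'F gs gs' zs zs' S NM; set u := lin _ z.
have [u0|] := ltP 0 u; last by move=> /le_trans; apply; rewrite lin_ge0.
have S' := separated_sim S (cell_separated zF gs zs NM u0 (lexx _)).
rewrite leNgt; apply/negP => lt.
have [M' [zM' M'N] M'min] : exists2 M', supp z' M' /\ ~~ (M' <= N)%O &
    forall N', supp z' N' -> ~~ (N' <= N)%O -> (M' <= N')%O.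
  apply: supp_least; apply: contrapT => no; move: lt; apply/negP;
    rewrite -leNgt.
  rewrite [leRHS](_ : _ = 1).
    by rewrite -(lin_cst 1 z); apply: ler_lin => N' _; case: (N' <= N)%O.
  rewrite -[RHS](lin_cst 1 z'); apply: eq_lin => N' zN'.
  by case: (boolP (N' <= N)%O) => // N'N; case: no; exists N'.
move/negP: M'N; apply; apply: (separated_le z'F gs' zs' S' u0).
- by have /cellFP/(_ _ zM') := z'F.
- exact: zs'.
apply: le_lt_trans lt; apply: ler_lin => N' zN'.
case: (boolP (N' <= N)%O) => [_|/(M'min _ zN') ->//].
by rewrite ler_nat; case: (_ <= _)%O.
Qed.

(** The weight of [z] strictly below [N] is its weight below the greatest member [N1] of its chain
    with [N1 < N], which reduces to the weak inequality. *)
Lemma sim_lt_lin z z' s s' N :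
  cellF R M z -> cellF R M z' -> good s -> good s' ->
  onsheet z s -> onsheet z' s' ->
  sim f g (xpos z \o s.1) (ypos z \o s.2) (xpos z' \o s'.1) (ypos z' \o s'.2) ->
  lin (fun N' => (N' < N)%O%:R) z <= lin (fun N' => (N' < N)%O%:R) z' :> R.
Proof.
move=> zF z'F gs gs' zs zs' S.
have [ex|no] := pselect (exists2 N1, supp z N1 & (N1 < N)%O); last first.
  rewrite (@lin_eq0 _ _ _ _ z) ?lin_ge0// => N' zN'.
  by case: (boolP (N' < N)%O) => // ?; case: no; exists N'.
have [N1 [zN1 N1N] N1max] := supp_greatest ex.
have N1M : (N1 <= M)%O by have /cellFP/(_ _ zN1) := zF.
apply: (@le_trans _ _ (lin (fun N' => (N' <= N1)%O%:R) z)).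
  apply: ler_lin => N' zN'; case: (boolP (N' < N)%O) => // N'N.
  by rewrite N1max.
apply: le_trans (sim_le_lin zF z'F gs gs' zs zs' S N1M) _.
apply: ler_lin => N' _; rewrite ler_nat.
by case: (boolP (N' <= N1)%O) => // /le_lt_trans/(_ N1N) ->.
Qed.

Lemma sim_eq z z' s s' : cellF R M z -> cellF R M z' -> good s -> good s' ->
  onsheet z s -> onsheet z' s' ->
  sim f g (xpos z \o s.1) (ypos z \o s.2) (xpos z' \o s'.1) (ypos z' \o s'.2) ->
  z = z'.
Proof.
move=> zF z'F gs gs' zs zs' S; have S' := sim_sym S.
apply: realization_ext => N.
have [NM|NM] := boolP (N <= M)%O; last first.
  rewrite !suppNE// => zN.
    by have /cellFP/(_ _ zN) := z'F; apply/negP.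
  by have /cellFP/(_ _ zN) := zF; apply/negP.
(* The barycentric coordinate at [N] is the jump between the weights below [N], taken with and
   without [N]. *)
have E z1 : lin (fun b => (b == N)%:R) z1 =
    lin (fun N' => (N' <= N)%O%:R) z1 - lin (fun N' => (N' < N)%O%:R) z1 :> R.
  rewrite -linB; apply: eq_lin => N' _; rewrite le_eqVlt.
  by case: eqP => [->|_]; rewrite ?ltxx ?subr0 //= subrr.
rewrite !E; congr (_ - _); apply/eqP; rewrite eq_le.
  by rewrite (sim_le_lin zF z'F gs gs' zs zs' S NM) (sim_le_lin z'F zF gs' gs
    zs' zs S' NM).
by rewrite (sim_lt_lin N zF z'F gs gs' zs zs' S) (sim_lt_lin N z'F zF gs' gs
  zs' zs S').
Qed.

(** The dilation carries a separation by [depth z] to one by [c * depth z], which the depth of [z']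
    bounds. *)
Lemma simZ_le1 z z' s s' c : cellF R M z -> cellF R M z' -> good s -> good s' ->
  onsheet z s -> onsheet z' s' -> depth z = depth z' -> 0 < depth z -> 0 < c ->
  sim f g (fun k => c * (xpos z \o s.1) k) (fun k => c * (ypos z \o s.2) k)
    (xpos z' \o s'.1) (ypos z' \o s'.2) -> c <= 1.
Proof.
move=> zF z'F gs gs' zs zs' dd d0 c0 S.
have [N NM Sz] := depth_separated zF gs zs d0.
have := separated_depth z'F gs' zs' (separated_sim S (separatedZ c0 Sz)).
by rewrite mulr_gt0// -dd => /(_ isT NM); rewrite ger_pMl.
Qed.

Lemma simZ_eq z z' s s' c : cellF R M z -> cellF R M z' -> good s -> good s' ->
  onsheet z s -> onsheet z' s' -> depth z = depth z' -> 0 < depth z -> 0 < c ->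
  sim f g (fun k => c * (xpos z \o s.1) k) (fun k => c * (ypos z \o s.2) k)
    (xpos z' \o s'.1) (ypos z' \o s'.2) -> z = z'.
Proof.
move=> zF z'F gs gs' zs zs' dd d0 c0 S.
have c1 := simZ_le1 zF z'F gs gs' zs zs' dd d0 c0 S.
have S' : sim f g (fun k => c^-1 * (xpos z' \o s'.1) k)
    (fun k => c^-1 * (ypos z' \o s'.2) k) (xpos z \o s.1) (ypos z \o s.2).
  have := simZ c^-1 (sim_sym S); congr sim; apply/funext => k;
    by rewrite mulrA mulVf ?mul1r// gt_eqF.
have c1' : c^-1 <= 1.
  by apply: simZ_le1 zF gs' gs zs' zs _ _ _ S' => //; rewrite -?dd ?invr_gt0.
have cE : c = 1.
  by apply/eqP; rewrite eq_le c1 /= -[leLHS]invr1 -[leRHS]invrK lef_pV2 ?posrE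
    ?invr_gt0 ?ltr01.
apply: (sim_eq zF z'F gs gs' zs zs'); move: S; rewrite cE.
by congr sim; apply/funext => k; rewrite mul1r.
Qed.

(** The zero configuration is fixed by dilations, so a separation by [depth z] would yield one by
    twice the depth. *)
Lemma not_sim0 z s : cellF R M z -> good s -> onsheet z s -> 0 < depth z ->
  ~ sim f g (fun=> 0) (fun=> 0) (xpos z \o s.1) (ypos z \o s.2).
Proof.
move=> zF gs zs d0 S.
have [N NM Sz] := depth_separated zF gs zs d0.
have S0 := separatedZ (ltr0n R 2) (separated_sim (sim_sym S) Sz).
have {}S0 : separated (fun=> 0) (fun=> 0) N (2 * depth z).
  by move: S0; congr separated; apply/funext => k; rewrite mulr0.
have := separated_depth zF gs zs (separated_sim S S0).
by rewrite mulr_gt0// => /(_ isT NM); lra.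
Qed.

End Sheets.

(** * Chains of threshold matrices *)

Lemma lexi_sorting (R : realType) n (f : 'I_n -> nat) (x : 'I_n -> R) :
  exists s : 'S_n, forall k l : 'I_n, (k <= l)%N ->
    (f (s k) < f (s l))%N || (f (s k) == f (s l)) && (x (s k) <= x (s l)).
Proof.
pose leT k l := (f k < f l)%N || (f k == f l) && (x k <= x l).
have leT_tr : transitive leT.
  move=> l k m; rewrite /leT => /orP[kl|/andP[/eqP -> kl]].
    by move=> /orP[lm|/andP[/eqP <- _]]; rewrite ?(ltn_trans kl lm) ?kl.
  by move=> /orP[->//|/andP[-> lm]]; rewrite (le_trans kl lm) orbT.
have leT_total : total leT.
  move=> k l; rewrite /leT; case: ltngtP => //= _; exact: le_total.
have leT_refl : reflexive leT by move=> k; rewrite /leT eqxx lexx orbT.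
pose t := sort leT (enum 'I_n).
have st : size t = n by rewrite size_sort size_enum_ord.
pose s k := nth k t k.
have s_inj : injective s.
  move=> k l; rewrite /s (set_nth_default l) ?st// => /eqP.
  by rewrite nth_uniq ?st// ?sort_uniq ?enum_uniq// => /eqP/val_inj.
exists (perm s_inj) => k l kl; rewrite !permE -/(leT _ _) /s.
rewrite (set_nth_default l) ?st//.
by apply: (sorted_leq_nth leT_tr leT_refl); rewrite ?inE ?st// sort_sorted.
Qed.

Section Cuts.
Variable n : nat.
Implicit Types (P : pred 'I_n) (r : 'I_n -> nat).

Definition cuts P : pred nat :=
  fun j => [exists i : 'I_n, (i == j :> nat) && P i].

Lemma cutsE P (i : 'I_n) : cuts P i = P i.
Proof.
apply/existsP/idP => [[k /andP[/eqP/val_inj -> //]]|Pi].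
by exists i; rewrite eqxx.
Qed.

(** Position 0 is its own predecessor: comparing neighbouring labels gives no cut there, in
    accordance with [cut_fun], which counts from 1. *)
Definition pred_ord (i : 'I_n) : 'I_n :=
  Ordinal (leq_ltn_trans (leq_pred i) (ltn_ord i)).

Lemma cut_fun_le (D D' : pred nat) (a b : 'I_n) : (forall j, D' j -> D j) ->
  (cut_fun D a <= cut_fun D b)%N -> (cut_fun D' a <= cut_fun D' b)%N.
Proof.
move=> D'D ab; have [|ba] := leqP a b; first exact: cut_fun_mono.
have split_at (E : pred nat) : cut_fun E a = (cut_fun E b + \sum_(b.+1 <= j <
  a.+1) E j)%N.
  by rewrite /cut_fun (@big_cat_nat _ _ _ b.+1)// ltnS ltnW.
move: ab; rewrite !split_at -{2}[cut_fun D b]addn0 leq_add2l leqn0 => /eqP D0.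
rewrite -{2}[cut_fun D' b]addn0 leq_add2l.
apply: leq_trans (_ : \sum_(b.+1 <= j < a.+1) D j <= 0)%N; last by rewrite D0.
by apply: leq_sum => j _; case: (boolP (D' j)) => // /D'D ->.
Qed.

Lemma cut_fun_cuts r : (forall k l : 'I_n, (k <= l)%N -> (r k <= r l)%N) ->
  (forall k l : 'I_n, l = k.+1 :> nat -> (r l <= (r k).+1)%N) ->
  (forall k : 'I_n, k = 0%N :> nat -> r k = 0%N) ->
  r = cut_fun (cuts (fun i => r i != r (pred_ord i))).
Proof.
move=> rm rs r0; apply/funext => -[k]; elim: k => [|k IH] kn.
  by rewrite r0// /cut_fun big_geq.
pose i := Ordinal (ltnW kn).
rewrite (@cut_fun_step _ _ i)// -IH -[k.+1]/(nat_of_ord (Ordinal kn)) cutsE.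
have -> : pred_ord (Ordinal kn) = i by apply/val_inj.
have le1 := rs i (Ordinal kn) erefl; have le2 := rm i (Ordinal kn) (leqnSn _).
by have [->|/eqP ne] := eqVneq (r (Ordinal kn)) (r i); rewrite ?addn0//= -/i;
  lia.
Qed.

(** The fibres of a monotone map are intervals, so comparing neighbours is enough. *)
Lemma fibre_constant (T : Type) r (U : 'I_n -> T) :
  (forall k l : 'I_n, (k <= l)%N -> (r k <= r l)%N) ->
  (forall i, r i = r (pred_ord i) -> U i = U (pred_ord i)) ->
  forall k l, r k = r l -> U k = U l.
Proof.
move=> rm rU.
suff H (k l : 'I_n) : (k <= l)%N -> r k = r l -> U k = U l.
  by move=> k l kl; have [/H->//|/ltnW/H->//] := leqP k l.
case: l => l; elim: l => [|l IH] ln kl rkl.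
  by congr U; apply/val_inj => /=; apply/eqP; rewrite -leqn0.
move: kl; rewrite leq_eqVlt => /predU1P[kl|]; first by congr U; apply/val_inj.
rewrite ltnS => kl.
have pE : pred_ord (Ordinal ln) = Ordinal (ltnW ln) by apply/val_inj.
have rE : r k = r (Ordinal (ltnW ln)).
  by apply/eqP; rewrite eqn_leq rm//= rkl rm /=.
by rewrite [RHS]rU ?pE -?rE ?rkl//; exact: IH.
Qed.

End Cuts.

Lemma rho_cuts n (N : CM n) :
  rho N = cut_fun (cuts (fun i => rho N i != rho N (pred_ord i))).
Proof.
apply: cut_fun_cuts; [exact: rho_mono|exact: rho_step|move=> k k0].
have [l l0] := rho_surj (leq_ltn_trans (leq0n _) (rho_lt N k)).
by apply/eqP; rewrite -leqn0 -l0 rho_mono// k0.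
Qed.

Lemma kappa_cuts n (N : CM n) :
  kappa N = cut_fun (cuts (fun i => kappa N i != kappa N (pred_ord i))).
Proof.
apply: cut_fun_cuts; [exact: kappa_mono|exact: kappa_step|move=> k k0].
have [l l0] := kappa_surj (leq_ltn_trans (leq0n _) (kappa_lt N k)).
by apply/eqP; rewrite -leqn0 -l0 kappa_mono// k0.
Qed.

Section Thresholds.
Variables (R : realType) (vs : seq R).
Hypotheses (vs0 : 0 \in vs) (vs1 : 1 \in vs).
Hypothesis vs01 : forall c, c \in vs -> 0 <= c <= 1.

Let N := (size vs).-1.
Definition threshold k := nth 0 (sort <=%R vs) k.

Lemma size_vs : size vs = N.+1.
Proof. by rewrite /N prednK//; case: (vs) vs0. Qed.

Lemma threshold_mono k l :
  (l <= N)%N -> (k <= l)%N -> threshold k <= threshold l.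
Proof.
move=> lN kl; apply: (sorted_leq_nth le_trans le_refl) => //.
- by rewrite sort_sorted//; exact: le_total.
- by rewrite inE size_sort size_vs ltnS (leq_trans kl).
- by rewrite inE size_sort size_vs ltnS.
Qed.

Lemma mem_threshold k : (k <= N)%N -> threshold k \in vs.
Proof. by move=> kN; rewrite -(mem_sort <=%R) mem_nth// size_sort size_vs. Qed.

Lemma thresholdP c : c \in vs -> exists2 k, (k <= N)%N & threshold k = c.
Proof.
rewrite -(mem_sort <=%R) => cs; exists (index c (sort <=%R vs));
  last exact: nth_index.
by rewrite -ltnS -size_vs -(size_sort <=%R) index_mem.
Qed.

Lemma threshold0 : threshold 0 = 0.
Proof.
have [k kN k0] := thresholdP vs0; apply/eqP; rewrite eq_le -{1}k0.
by rewrite threshold_mono//=; have /andP[] := vs01 (mem_threshold (leq0n N)).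
Qed.

Lemma thresholdN : threshold N = 1.
Proof.
have [k kN k1] := thresholdP vs1; apply/eqP; rewrite eq_le -{2}k1.
by rewrite threshold_mono//= andbT; have /andP[] := vs01 (mem_threshold (leqnn
  N)).
Qed.

(** Since [0.-1] is [0], the first weight is zero; the others telescope from the least threshold 0
    to the greatest threshold 1. *)
Definition threshold_weight k := threshold k - threshold k.-1.

Lemma telescope_pred (u : nat -> R) m :
  \sum_(k < m.+1) (u k - u k.-1) = u m - u 0%N.
Proof.
elim: m => [|m IH]; first by rewrite big_ord1.
by rewrite big_ord_recr /= IH addrC subrKA.
Qed.

Lemma threshold_weight_ge0 k : (k <= N)%N -> 0 <= threshold_weight k.
Proof. by move=> kN; rewrite subr_ge0 threshold_mono// leq_pred. Qed.

Lemma sum_threshold_weight : \sum_(k < N.+1) threshold_weight k = 1.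
Proof. by rewrite telescope_pred thresholdN threshold0 subr0. Qed.

(** A layer-cake formula. Capping the thresholds at [c] turns every term into a difference, so that
    the sum telescopes. *)
Lemma sum_threshold_le c : c \in vs ->
  \sum_(k < N.+1) threshold_weight k * (threshold k <= c)%R%:R = c.
Proof.
move=> cvs; have /andP[c0 c1] := vs01 cvs.
transitivity (\sum_(k < N.+1) (Num.min (threshold k) c - Num.min (threshold
  k.-1) c)).
  apply: eq_bigr => -[k /= kN] _; rewrite ltnS in kN.
  have km := threshold_mono kN (leq_pred k).
  have [kc|ck] := leP (threshold k) c.
    by rewrite mulr1 (min_l (le_trans km kc)).
  rewrite mulr0.
  have [l lN lc] := thresholdP cvs.
  have lk : (l < k)%N.
    by rewrite ltnNge; apply/negP => /(threshold_mono lN); rewrite lc leNgt ck.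
  rewrite min_r ?subrr// -lc threshold_mono//; last by case: (k) lk.
  exact: leq_trans (leq_pred _) kN.
rewrite (telescope_pred (fun k => Num.min (threshold k) c)).
by rewrite thresholdN threshold0 min_r// min_l// subr0.
Qed.

End Thresholds.

Section Surjectivity.
Variables (R : realType) (n : nat) (n_gt0 : (0 < n)%N).
Variables (M : CM n) (f g : 'I_n -> nat) (Mfg : lab M f g).
Variables (x y : 'I_n -> R) (v : R).
Hypotheses (v_gt0 : 0 < v) (v_le1 : v <= 1).
Hypothesis nsim : ~ sim f g (fun=> 0) (fun=> 0) x y.

Lemma good_sorting : exists s : 'S_n * 'S_n, good M f g s /\
  (forall k l : 'I_n, (k <= l)%N -> rho M k = rho M l ->
    x (s.1^-1%g k) <= x (s.1^-1%g l)) /\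
  (forall k l : 'I_n, (k <= l)%N -> kappa M k = kappa M l ->
    y (s.2^-1%g k) <= y (s.2^-1%g l)).
Proof.
have [s sP] := lexi_sorting f x; have [t tP] := lexi_sorting g y.
have fE : f \o s = rho M.
  rewrite (rhoE Mfg); apply: (@sorted_fun_unique _ _ s^-1%g) => [k l /sP|k] /=.
    by case/orP => [/ltnW//|/andP[/eqP ->]].
  by rewrite permKV.
have gE : g \o t = kappa M.
  rewrite (kappaE Mfg); apply: (@sorted_fun_unique _ _ t^-1%g) =>
    [k l /tP|k] /=.
    by case/orP => [/ltnW//|/andP[/eqP ->]].
  by rewrite permKV.
exists (s^-1, t^-1)%g; split; last split.
- by split=> k; rewrite /= -?fE -?gE /= permKV.
- by rewrite -fE /= invgK => k l /sP /orP[fkl E|/andP[_]//];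
  rewrite E ltnn in fkl.
- by rewrite -gE /= invgK => k l /tP /orP[fkl E|/andP[_]//];
  rewrite E ltnn in fkl.
Qed.

(* The chain consists of the matrices whose cuts are the gaps above a
   threshold, for the thresholds among the values of the gaps. *)
Lemma exists_config : exists z s lambda, [/\ cellF R M z, depth M z = v,
  good M f g s, onsheet z s & 0 < lambda /\
  sim f g (fun k => lambda * x k) (fun k => lambda * y k)
    (xpos z \o s.1) (ypos z \o s.2)].
Proof.
have [s [gs [xs ys]]] := good_sorting.
pose r (b : bool) : 'I_n -> nat := if b then kappa M else rho M.
pose X (b : bool) i := if b then y (s.2^-1%g i) else x (s.1^-1%g i).
have Xm b (k l : 'I_n) : (k <= l)%N -> r b k = r b l -> X b k <= X b l.
  by case: b; [exact: ys|exact: xs].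
pose gap (ib : 'I_n * bool) := if r ib.2 ib.1 == r ib.2 (pred_ord ib.1)
  then X ib.2 ib.1 - X ib.2 (pred_ord ib.1) else 0.
have gap_ge0 ib : 0 <= gap ib.
  by rewrite /gap; case: eqP => // rE; rewrite subr_ge0 Xm// leq_pred.
pose ib0 : 'I_n * bool := (Ordinal n_gt0, true).
pose top := [arg max_(ib > ib0) gap ib]%O.
have gap_top ib : gap ib <= gap top.
  by rewrite /top; case: arg_maxP => // i _ /(_ ib isT).
(* If all gaps vanished, [x] would be constant on rows and [y] on columns of [M]: a translate of the
   zero configuration, against [nsim]. *)
have top_gt0 : 0 < gap top.
  rewrite lt_neqAle gap_ge0 andbT; apply/negP => /eqP top0.
  have X_const b (k l : 'I_n) : r b k = r b l -> X b k = X b l.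
    apply: fibre_constant => [i j|i ri].
      by case: b; [exact: kappa_mono|exact: rho_mono].
    have := gap_top (i, b); rewrite -top0 /gap /= ri eqxx => le0.
    by apply/eqP; rewrite -subr_eq0 eq_le le0 subr_ge0 Xm// leq_pred.
  apply: nsim.
  have [a ax] : exists a : nat -> R, forall k, x k = a (f k).
    apply: fibre_translation => k l; rewrite !gs.1 => /(X_const false).
    by rewrite /X !permK.
  have [b by_] : exists b : nat -> R, forall k, y k = b (g k).
    apply: fibre_translation => k l; rewrite !gs.2 => /(X_const true).
    by rewrite /X !permK.
  exists 1%g, a, b; split=> k; rewrite ?perm1// add0r//.
pose lambda := v / gap top.
have lambda_gt0 : 0 < lambda by rewrite divr_gt0.
(* Gaps inside the rows and columns of [M] are scaled so that the largest is [v]. The cuts of [M]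
   get the value 1: they survive every threshold up to 1 and keep the chain below [M]. *)
pose gam (ib : 'I_n * bool) := if r ib.2 ib.1 == r ib.2 (pred_ord ib.1)
  then lambda * gap ib else 1.
have lgap_le ib : lambda * gap ib <= v.
  by rewrite /lambda mulrAC ler_pdivrMr// ler_pM2l.
have gam01 ib : 0 <= gam ib <= 1.
  rewrite /gam; case: eqP => _; last by rewrite ler01 lexx.
  by rewrite mulr_ge0 ?(ltW lambda_gt0)//= (le_trans (lgap_le _)).
have top_r : r top.2 top.1 = r top.2 (pred_ord top.1).
  by apply/eqP; move: top_gt0; rewrite /gap; case: eqP => //; rewrite ltxx.
have gam_top : gam top = v by rewrite /gam top_r eqxx divfK// gt_eqF.
(* The values 0 and 1 are adjoined so that the weights add up to 1. *)
pose vs := [:: 0, 1 & [seq gam ib | ib : 'I_n * bool]].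
have vs0 : 0 \in vs by rewrite inE eqxx.
have vs1 : 1 \in vs by rewrite !inE eqxx orbT.
have vs_gam ib : gam ib \in vs by rewrite !inE map_f ?orbT// mem_enum.
have vs01 c : c \in vs -> 0 <= c <= 1.
  rewrite !inE => /or3P[/eqP->|/eqP->|/mapP[ib _ ->]//].
    by rewrite lexx ler01.
  by rewrite ler01 lexx.
have [NN NNP] := choice (fun th : R => sheet_of_cuts
  (cuts (fun i => th <= gam (i, false))) (cuts (fun i =>
    th <= gam (i, true))) s n_gt0).
have NN_le th th' : th <= th' -> (NN th <= NN th')%O.
  move=> tt'; have [L rE kE] := NNP th; have [L' rE' kE'] := NNP th'.
  apply: (le_sheet L L'); rewrite ?rE ?rE' ?kE ?kE' => k l;
    apply: cut_fun_le => j /existsP[i /andP[ij ti]]; apply/existsP; exists i;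
    by rewrite ij (le_trans tt').
have NN_M th : th <= 1 -> (NN th <= M)%O.
  move=> th1; have [L rE kE] := NNP th.
  apply: (le_sheet L (good_sheet Mfg gs)) => k l;
    [rewrite rE (rho_cuts M)|rewrite kE (kappa_cuts M)];
    apply: cut_fun_le => j /existsP[i /andP[ij ri]]; apply/existsP; exists i;
    by rewrite ij /gam /= (negbTE ri).
(* Above [v] only cuts of [M] are left, whereas up to [v] the cut at the largest gap survives; so
   the members other than [M] have total weight [v]. *)
have M_NN th : v < th -> (M <= NN th)%O.
  move=> vth; have [L rE kE] := NNP th.
  have key i b : th <= gam (i, b) -> r b i != r b (pred_ord i).
    rewrite /gam /=; case: eqP => // _ /(lt_le_trans vth).
    by rewrite ltNge lgap_le.
  apply: (le_sheet (good_sheet Mfg gs) L) => k l;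
    [rewrite rE (rho_cuts M)|rewrite kE (kappa_cuts M)];
    apply: cut_fun_le => j /existsP[i /andP[ij /key ri]]; apply/existsP;
      exists i;
    by rewrite ij.
have NN_step th i b : i != pred_ord i ->
    ((if b then kappa (NN th) i else rho (NN th) i) =
     (if b then kappa (NN th) (pred_ord i) else rho (NN th) (pred_ord i)) + (th
       <= gam (i, b))%R)%N.
  move=> ip; have [L rE kE] := NNP th.
  have iS : i = (pred_ord i).+1 :> nat.
    by rewrite /= prednK// lt0n; apply: contra ip => /eqP i0;
      apply/eqP/val_inj; rewrite /= i0.
  by case: b; rewrite ?rE ?kE (@cut_fun_step _ _ (pred_ord i) i)// cutsE.
have NN_neq th : th <= v -> NN th != M.
  move=> thv; apply/eqP => E.
  have topp : top.1 != pred_ord top.1.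
    by apply/eqP => tp; move: top_gt0; rewrite /gap -tp eqxx subrr ltxx.
  have := NN_step th _ top.2 topp; rewrite E -surjective_pairing gam_top thv.
  by move: top_r; rewrite /r; case: top.2 => ->; lia.
pose N := (size vs).-1.
have [t tE] := @mk_nerve _ (CM n) N (fun k => NN (threshold vs k))
  (fun i j ij => NN_le _ _ (threshold_mono vs0 (ltn_ord j : (j <= N)%N) ij)).
have wS : @simplex R N (\row_k threshold_weight vs k).
  split=> [k|]; first by rewrite mxE threshold_weight_ge0// -ltnS ltn_ord.
  by under eq_bigr do rewrite mxE; exact: sum_threshold_weight.
pose w : @simplex R N := SigSub (mem_set wS).
have zlin h : lin h (real_point t w) =
    \sum_(k < N.+1) threshold_weight vs k * h (NN (threshold vs k)).
  by rewrite linE; apply: eq_bigr => k _; rewrite tE mxE.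
have gapE i b : i != pred_ord i ->
    lin (fun N => (if b then kappa N i else rho N i)%:R) (real_point t w) -
    lin (fun N => (if b then kappa N (pred_ord i) else rho N (pred_ord i))%:R)
      (real_point t w) = gam (i, b).
  move=> ip; rewrite -linB zlin -[RHS](sum_threshold_le vs0 vs1 vs01 (vs_gam
    _)).
  by apply: eq_bigr => k _; rewrite NN_step// natrD addrAC subrr add0r.
(* Realized and prescribed gaps agree inside the rows and columns of [M], so the discrepancy depends
   on the label only: it is a translation. *)
have fib b : forall k l, r b k = r b l ->
    lin (fun N => (if b then kappa N k else rho N k)%:R) (real_point t w) -
      lambda * X b k =
    lin (fun N => (if b then kappa N l else rho N l)%:R) (real_point t w) -
      lambda * X b l.
  apply: fibre_constant => [i j|i ri].
    by case: b; [exact: kappa_mono|exact: rho_mono].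
  have [ip|ip] := eqVneq i (pred_ord i); first by rewrite -ip.
  have := gapE i b ip; rewrite /gam /= ri eqxx /gap /= ri eqxx; lra.
exists (real_point t w), s, lambda; split=> //.
- apply/cellFP => N' /supp_real_pointP[k _ <-]; rewrite tE NN_M//.
  by have /andP[] := vs01 _ (mem_threshold vs0 (ltn_ord k : (k <= N)%N)).
- rewrite depthE zlin -[RHS]gam_top -[RHS](sum_threshold_le vs0 vs1 vs01
  (vs_gam top)).
  apply: eq_bigr => k _; rewrite gam_top; congr (_ * _%:R).
  have [/NN_neq ->//|vk] := leP (threshold vs k) v.
  apply/eqP; rewrite eqb0 negbK eq_le M_NN// NN_M//.
  by have /andP[] := vs01 _ (mem_threshold vs0 (ltn_ord k : (k <= N)%N)).
- move=> N' /supp_real_pointP[k _ <-]; rewrite tE.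
  by have [] := NNP (threshold vs k).
split=> //.
have [a aP] := fibre_translation (fib false); have [b bP] := fibre_translation
  (fib true).
exists 1%g, a, b; split=> k; rewrite ?perm1//.
  by have := aP (s.1 k); rewrite /X /r /= permK -gs.1 => <-;
    rewrite addrCA subrr addr0.
by have := bP (s.2 k); rewrite /X /r /= permK -gs.2 => <-;
  rewrite addrCA subrr addr0.
Qed.

End Surjectivity.

(** * Homeomorphisms with balls and spheres *)

Section SetHomeomorphism.
Variables (X Y : topologicalType).
Implicit Types (A : set X) (B : set Y) (F : X -> Y) (G : Y -> X).

(** Total maps rather than maps of subtypes: one pair then restricts to the closed cell, the open
    cell and the boundary sphere. *)
Record set_homeo A B F G : Prop := SetHomeo {
  set_homeo_cont : {within A, continuous F};
  set_homeo_inv_cont : {within B, continuous G};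
  set_homeo_to : forall z, A z -> B (F z) /\ G (F z) = z;
  set_homeo_of : forall w, B w -> A (G w) /\ F (G w) = w }.

Lemma set_homeoW A B A' B' F G : set_homeo A B F G ->
  A' `<=` A -> B' `<=` B -> (forall z, A z -> A' z <-> B' (F z)) ->
  set_homeo A' B' F G.
Proof.
move=> [Fc Gc FB GA] A'A B'B A'B'; split.
- exact: continuous_subspaceW Fc.
- exact: continuous_subspaceW Gc.
- by move=> z A'z; have Az := A'A z A'z; split; [exact/A'B'|have [] := FB z Az].
- move=> w B'w; have [AGw FGw] := GA w (B'B w B'w); split=> //.
  by apply/A'B' => //; rewrite FGw.
Qed.

Lemma set_homeo_compact A B F : hausdorff_space Y -> compact A ->
  {within A, continuous F} -> (forall z, A z -> B (F z)) ->
  (forall z z', A z -> A z' -> F z = F z' -> z = z') ->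
  (forall w, B w -> exists2 z, A z & F z = w) ->
  (exists z, A z) -> exists G, set_homeo A B F G.
Proof.
move=> hY cA Fc FB Finj Fsurj [z0 Az0].
pose G w := xget z0 [set z | A z /\ F z = w].
have GP w : B w -> A (G w) /\ F (G w) = w.
  move=> /Fsurj[z Az Fz]; rewrite /G.
  by case: xgetP => [z' _ //|/(_ z) no]; case: no.
have GF z : A z -> G (F z) = z.
  by move=> Az; have [AG FG] := GP _ (FB _ Az); exact: Finj.
exists G; split=> //; last by move=> z Az; split; [exact: FB|exact: GF].
apply/continuous_closedP => C cC; apply/closed_subspaceP.
(* The preimage of [C] under the inverse is the image of a compact set, hence closed in the
   Hausdorff space [Y]. *)
exists (F @` (A `&` C)).
  apply: (compact_closed hY); apply: continuous_compact.
    by apply: continuous_subspaceW Fc => z [].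
  exact: compact_closedI.
apply/seteqP; split=> [w [[z [Az Cz] <-] Bw]|w [/= CGw Bw]].
  by split=> //; change (C (G (F z))); rewrite GF.
by split=> //; have [AG FG] := GP w Bw; exists (G w).
Qed.

End SetHomeomorphism.

Lemma set_homeo_sym (X Y : topologicalType) (A : set X) (B : set Y) F G :
  set_homeo A B F G -> set_homeo B A G F.
Proof. by case=> Fc Gc FB GA; split. Qed.

Lemma set_homeo_homeomorphism (X Y : topologicalType) (A : set X) (B : set Y)
    F G :
  set_homeo A B F G ->
  exists2 h : A -> B, homeomorphism h & forall a, val (h a) = F (val a).
Proof.
move=> [Fc Gc FB GA].
pose h (a : A) : B := SigSub (mem_set (FB _ (set_valP a)).1).
pose k (b : B) : A := SigSub (mem_set (GA _ (set_valP b)).1).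
exists h => //; split.
  apply: (@continuous_comp_initial _ _ _ set_val h).
  by move/subspace_sigL_continuousP : Fc; apply.
exists k.
  apply: (@continuous_comp_initial _ _ _ set_val k).
  by move/subspace_sigL_continuousP : Gc; apply.
split=> a; apply/val_inj => /=.
  by have [] := FB _ (set_valP a).
by have [] := GA _ (set_valP a).
Qed.

Lemma continuous_rV (R : realType) (X : topologicalType) d (F : X -> 'rV[R]_d) :
  (forall i, continuous (fun x => F x ord0 i)) -> continuous F.
Proof.
move=> Fc x; apply/cvg_ballP => e e0.
have : \forall z \near x, forall i : 'I_d, ball (F x ord0 i) e (F z ord0 i).
  by apply: filter_forall => i; have /cvg_ballP := Fc i x; apply.
apply: filterS => z zi; split=> // i j.
by rewrite (ord1 i).
Qed.

Lemma continuous_paste (X : topologicalType) (Y : topologicalType) (I : finType)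
    (A : set X) (B : I -> set X) (G : I -> X -> Y) (f : X -> Y) :
  (forall i, closed (B i)) -> (forall i, continuous (G i)) ->
  (forall z, A z -> exists i, B i z) ->
  (forall i z, A z -> B i z -> f z = G i z) -> {within A, continuous f}.
Proof.
move=> Bc Gc AB fG; apply/continuous_closedP => C cC; apply/closed_subspaceP.
exists (\big[setU/set0]_(i : I) (B i `&` G i @^-1` C)).
  apply: closed_bigsetU => i _; apply: closedI => //.
  by apply: preimage_closed => // z _; exact: Gc.
apply/seteqP; split=> z [].
  move=> + Az; elim/big_ind : _ => // [S T HS HT [/HS|/HT]//|i _ [Bz Cz]].
  by split=> //; change (C (f z)); rewrite (fG i).
move=> Cz Az; split=> //; have [i Bz] := AB z Az.
by rewrite (bigD1 i)//=; left; split=> //; change (C (G i z)); rewrite -fG.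
Qed.

Section Euclidean.
Variables (R : realType) (d : nat).
Implicit Types u : 'rV[R]_d.

Lemma sqnorm_ge0 u : 0 <= sqnorm u.
Proof. by apply: sumr_ge0 => i _; exact: sqr_ge0. Qed.

Lemma sqnormZ c u : sqnorm (c *: u) = c ^+ 2 * sqnorm u.
Proof. by rewrite [RHS]mulr_sumr; apply: eq_bigr => i _;
  rewrite mxE exprMn. Qed.

Lemma sqnorm_eq0 u : sqnorm u = 0 -> u = 0.
Proof.
move=> /eqP; rewrite psumr_eq0 => [/allP u0|i _]; last exact: sqr_ge0.
apply/rowP => i; rewrite mxE; apply/eqP; rewrite -sqrf_eq0.
by apply: (implyP (u0 i _)) => //; rewrite mem_index_enum.
Qed.

Definition enorm u := Num.sqrt (sqnorm u).

Lemma enorm_gt0 u : u != 0 -> 0 < enorm u.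
Proof.
move=> u0; rewrite sqrtr_gt0 lt_neqAle sqnorm_ge0 andbT eq_sym.
by apply: contra u0 => /eqP/sqnorm_eq0 ->.
Qed.

Lemma enormZ c u : 0 <= c -> enorm (c *: u) = c * enorm u.
Proof.
by move=> c0; rewrite /enorm sqnormZ sqrtrM ?sqr_ge0// sqrtr_sqr ger0_norm.
Qed.

Lemma norm_coord_le_enorm u i : `|u ord0 i| <= enorm u.
Proof.
rewrite -sqrtr_sqr ler_wsqrtr// /sqnorm (bigD1 i)//= lerDl.
by apply: sumr_ge0 => j _; exact: sqr_ge0.
Qed.

Lemma continuous_enorm (X : topologicalType) (F : X -> 'rV[R]_d) z :
  (forall i, {for z, continuous (fun x => F x ord0 i)}) ->
  {for z, continuous (fun x => enorm (F x))}.
Proof.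
move=> Fc; apply: (@continuous_comp _ _ _ (fun x => sqnorm (F x)) Num.sqrt).
  apply: cvg_big => [|i _]; first exact: add_continuous.
  exact: (@continuousM _ _ (fun x => F x ord0 i) (fun x =>
    F x ord0 i) _ (Fc i) (Fc i)).
exact: sqrt_continuous.
Qed.

End Euclidean.

Section CellHomeomorphism.
Variables (R : realType) (n : nat) (n_gt0 : (0 < n)%N).
Variables (M : CM n) (f g : 'I_n -> nat) (Mfg : lab M f g).
Implicit Types z : stochastihedron R n.

Let d := #|kept_coords f g|.

Definition sheet_of z := xget (1, 1)%g [set s | good M f g s /\ onsheet z s].

Definition cell_chart z : 'rV[R]_d :=
  chart f g (xpos z \o (sheet_of z).1) (ypos z \o (sheet_of z).2).

Lemma sheet_ofP z :
  cellF R M z -> good M f g (sheet_of z) /\ onsheet z (sheet_of z).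
Proof.
move=> zM; rewrite /sheet_of; case: xgetP => [s _ //|no].
by have [s gs zs] := exists_sheet Mfg zM; case: (no s).
Qed.

Lemma cell_chartE z s : cellF R M z -> good M f g s -> onsheet z s ->
  cell_chart z = chart f g (xpos z \o s.1) (ypos z \o s.2).
Proof.
move=> zM gs zs; have [gs' zs'] := sheet_ofP zM.
exact/chart_sim/(sheet_sim zM).
Qed.

(** The sheet chosen by [sheet_of] may jump, but any good sheet of [z] computes the chart. For each
    of the finitely many sheets, the points on it form a closed set on which one continuous formula
    holds. *)
Lemma continuous_cell_chart i :
  {within cellF R M, continuous (fun z => cell_chart z ord0 i)}.
Proof.
pose B (s : 'S_n * 'S_n) : set (stochastihedron R n) :=
  [set z | good M f g s /\ subrealization [set N | sheet N s] z].
pose G (s : 'S_n * 'S_n) z :=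
  chart_coord f g (fun k => xpos z (s.1 k)) (fun k =>
    ypos z (s.2 k)) (enum_val i).
apply: (@continuous_paste _ _ _ _ B G).
- move=> s; have [gs|ngs] := pselect (good M f g s).
    rewrite (_ : B s = subrealization [set N | sheet N s]).
      exact: closed_subrealization.
    by apply/seteqP; split=> z // [].
  rewrite (_ : B s = set0); first exact: closed0.
  by apply/seteqP; split=> z // [].
- move=> s; apply: continuous_chart_coord => k; exact: continuous_lin.
- move=> z /(exists_sheet Mfg)[s gs zs]; exists s; split=> //.
  exact/subrealizationP.
- move=> s z zM [gs /subrealizationP zs].
  by rewrite (cell_chartE zM gs zs) mxE.
Qed.

Lemma cell_chart_neq0 z : cellF R M z -> 0 < depth M z -> cell_chart z != 0.
Proof.
move=> zM d0; have [gs zs] := sheet_ofP zM.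
apply/eqP => Q0; apply: (not_sim0 Mfg zM gs zs d0).
by apply: chart_inj; rewrite chart00 -/(cell_chart z) Q0.
Qed.

(** Polar coordinates: the direction comes from the chart, the radius is the depth. *)
Definition ball_map z : 'rV[R]_d :=
  (depth M z / enorm (cell_chart z)) *: cell_chart z.

Lemma enorm_ball_map z : cellF R M z -> enorm (ball_map z) = depth M z.
Proof.
move=> zM; rewrite enormZ ?divr_ge0 ?depth_ge0 ?sqrtr_ge0//.
have [d0|] := ltP 0 (depth M z).
  by rewrite divfK// gt_eqF// enorm_gt0// cell_chart_neq0.
move=> d0; have -> : depth M z = 0 by apply/eqP; rewrite eq_le d0 depth_ge0.
by rewrite !mul0r.
Qed.

Lemma sqnorm_ball_map z : cellF R M z -> sqnorm (ball_map z) = depth M z ^+ 2.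
Proof. by move=> zM; rewrite -(enorm_ball_map zM) sqr_sqrtr// sqnorm_ge0. Qed.

Lemma continuous_depth : continuous (depth M : stochastihedron R n -> R).
Proof.
have c : continuous (fun z => 1 - lin (fun N => (N == M)%:R) z : R).
  move=> z; apply: (@continuousB R R^o _ (fun=> 1));
    first exact: cst_continuous.
  exact: continuous_lin.
exact: c.
Qed.

Lemma ball_map_coord_le z i : `|ball_map z ord0 i| <= depth M z.
Proof.
rewrite mxE normrM ger0_norm ?divr_ge0 ?depth_ge0 ?sqrtr_ge0//.
have [Q0|Q0] := eqVneq (cell_chart z) 0.
  by rewrite Q0 mxE normr0 mulr0 depth_ge0.
rewrite mulrAC ler_pdivrMr ?enorm_gt0// ler_wpM2l ?depth_ge0//.
exact: norm_coord_le_enorm.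
Qed.

Lemma continuous_ball_map : {within cellF R M, continuous ball_map}.
Proof.
apply: (@continuous_rV _ (subspace (cellF R M))) => i.
rewrite continuous_subspace_in => z /set_mem zM.
have depth_c : {for z, continuous (depth M : subspace (cellF R M) -> R)}.
  have : {within cellF R M, continuous (depth M : _ -> R)}.
    exact/continuous_subspaceT/continuous_depth.
  exact.
(* At depth 0 there is no direction to follow; continuity comes from the bound of each coordinate by
   the depth. *)
have [d0|d0] := ltP 0 (depth M z); last first.
  have {}d0 : depth M z = 0 by apply/eqP; rewrite eq_le d0 depth_ge0.
  have b0 : ball_map z ord0 i = 0.
    by apply/eqP; rewrite -normr_le0 -d0 ball_map_coord_le.
  apply/cvgrPdist_lt => e e0; rewrite b0.
  have /cvgrPdist_lt/(_ e e0) := depth_c; apply: filterS => z'.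
  rewrite d0 !sub0r !normrN; apply: le_lt_trans.
  rewrite (ger0_norm (depth_ge0 _ _)); exact: ball_map_coord_le.
have Qc j : {for z, continuous (fun z : subspace (cellF R M) =>
  cell_chart z ord0 j)}.
  have : {within cellF R M, continuous (fun z => cell_chart z ord0 j)}.
    exact: continuous_cell_chart.
  exact.
have Ec := @continuous_enorm R d (subspace (cellF R M)) cell_chart z Qc.
have E0 : enorm (cell_chart z) != 0 by rewrite gt_eqF// enorm_gt0//
  cell_chart_neq0.
under eq_fun do rewrite mxE.
apply: (@continuousM _ (subspace (cellF R M)) (fun z =>
  depth M z / enorm (cell_chart z))); last exact: Qc.
apply: (@continuousM _ (subspace (cellF R M)) (depth M)); first exact: depth_c.
have := @continuousV R (subspace (cellF R M)) (fun z =>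
  enorm (cell_chart z)) z E0 Ec.
exact.
Qed.

Lemma ball_map_inj z z' : cellF R M z -> cellF R M z' ->
  ball_map z = ball_map z' -> z = z'.
Proof.
move=> zM z'M E.
have dd : depth M z = depth M z' by rewrite -!enorm_ball_map// E.
have [d0|d0] := ltP 0 (depth M z); last first.
  have d0' : depth M z = 0 by apply/eqP; rewrite eq_le d0 depth_ge0.
  have w1 y : depth M y = 0 -> forall N, lin (fun b =>
    (b == N)%:R) y = (M == N)%:R :> R.
    by move=> /depth_eq0 yM N; rewrite -[RHS](lin_cst _ y);
      apply: eq_lin => N' /yM ->.
  by apply: realization_ext => N; rewrite !w1// -dd.
have [gs zs] := sheet_ofP zM; have [gs' zs'] := sheet_ofP z'M.
have Q0 : 0 < enorm (cell_chart z) by rewrite enorm_gt0// cell_chart_neq0.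
have Q0' : 0 < enorm (cell_chart z') by rewrite enorm_gt0// cell_chart_neq0//
  -dd.
pose c := enorm (cell_chart z') / enorm (cell_chart z).
have c0 : 0 < c by rewrite divr_gt0.
have QE : cell_chart z' = c *: cell_chart z.
  move: E; rewrite /ball_map -dd => /(congr1 (fun u =>
    (enorm (cell_chart z') / depth M z) *: u)).
  rewrite !scalerA !mulrA !divfK ?gt_eqF// divff ?gt_eqF// scale1r => <-.
  by [].
(* A dilation by [l] multiplies charts by the n!-th power of [l], so the ratio [c] of the two charts
   comes from a dilation of configurations. *)
have [l l0 lc] : exists2 l, 0 < l & l ^+ n`! = c.
  exists (c `^ (n`!%:R^-1)); first exact: powR_gt0.
  by rewrite -powR_mulrn ?powR_ge0// -powRrM mulVf ?powRr1 ?(ltW c0)//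
    pnatr_eq0 -lt0n fact_gt0.
apply: (simZ_eq Mfg zM z'M gs gs' zs zs' dd d0 l0).
apply: chart_inj; rewrite chartZ ?(ltW l0)// lc -/(cell_chart z).
exact: esym.
Qed.

Lemma ball_map_surj u :
  sqnorm u <= 1 -> exists2 z, cellF R M z & ball_map z = u.
Proof.
move=> u1; have [->|u0] := eqVneq u 0.
  have [z zM] := vertexP R M.
  have zF : cellF R M z by apply/cellFP => N /zM ->.
  exists z => //; rewrite /ball_map.
  rewrite (_ : depth M z = 0) ?mul0r ?scale0r//.
  by rewrite depthE lin_eq0// => N /zM ->; rewrite eqxx.
have [x [y xy]] := chart_surj u.
have v0 := enorm_gt0 u0.
have v1 : enorm u <= 1 by rewrite -sqrtr1 ler_wsqrtr.
have nsim : ~ sim f g (fun=> 0) (fun=> 0) x y.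
  by move=> /chart_sim; rewrite xy chart00 => /esym/eqP; exact/negP.
(* The configuration [(x, y)] has the direction of [u]; a dilation of it is realized by a point
   whose depth is the prescribed radius. *)
have [z [s [l [zM zd gs zs [l0 S]]]]] := exists_config n_gt0 Mfg v0 v1 nsim.
exists z => //; rewrite /ball_map (cell_chartE zM gs zs) -(chart_sim S).
rewrite chartZ ?(ltW l0)// xy zd enormZ ?exprn_ge0 ?(ltW l0)// scalerA.
have lD : l ^+ n`! != 0 by rewrite expf_neq0// gt_eqF.
have u00 : enorm u != 0 by rewrite gt_eqF.
by rewrite invfM mulrCA divff// mulr1 mulVf// scale1r.
Qed.

Lemma compact_cellF : compact (cellF R M).
Proof.
by have [s sP] := CM_finite n; exact: (compact_subrealization (s := s)).
Qed.

Lemma cell_set_homeo : exists G,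
  set_homeo (cellF R M) (unit_closed_ball R d) ball_map G.
Proof.
apply: set_homeo_compact.
- exact: norm_hausdorff.
- exact: compact_cellF.
- exact: continuous_ball_map.
- move=> z zM; rewrite /unit_closed_ball /= sqnorm_ball_map//.
  by rewrite expr_le1// ?depth_le1 ?depth_ge0.
- exact: ball_map_inj.
- by move=> u /ball_map_surj.
- by have [z zM] := vertexP R M; exists z; apply/cellFP => N /zM ->.
Qed.

End CellHomeomorphism.

Local Close Scope ring_scope.

(** * Open cells, their closures and dimensions *)

Section Stratification.
Variables (R : realType) (n : nat).
Implicit Types (M N : CM n) (z : stochastihedron R n).

Definition cell_dim M : nat := (2 * n - (nrows M + ncols M))%N.

(** A contingency matrix has at most [n] rows and [n] columns, so the subtraction in [cell_dim] is
    never truncated. *)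
Lemma cell_dim_lt N M : (N < M)%O -> (cell_dim N < cell_dim M)%N.
Proof.
rewrite lt_neqAle => /andP[/eqP NM /asboolP/cm_contracts_size[//|lt]].
have rN : (nrows N <= n)%N by apply: leq_of_surj => a; exact: rho_surj.
have cN : (ncols N <= n)%N by apply: leq_of_surj => a; exact: kappa_surj.
by rewrite /cell_dim; lia.
Qed.

Lemma cell_dim_le N M : (N <= M)%O -> (cell_dim N <= cell_dim M)%N.
Proof. by rewrite le_eqVlt => /predU1P[->//|/cell_dim_lt/ltnW]. Qed.

Lemma exists_cell_homeo (n_gt0 : (0 < n)%N) M : exists F G,
  set_homeo (cellF R M) (unit_closed_ball R (cell_dim M)) F G /\
  (forall z, cellF R M z -> sqnorm (F z) = depth M z ^+ 2)%R.
Proof.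
have [f [g L]] := lab_ex M.
have E := card_kept_coords (labels_row L) (lab_row_surj L) (labels_col L)
  (lab_col_surj L).
(* The maps are bound existentially before [E] is rewritten, because their types depend on the
   dimension. *)
have : exists F G,
    set_homeo (cellF R M) (unit_closed_ball R #|kept_coords f g|) F G /\
    (forall z, cellF R M z -> sqnorm (F z) = depth M z ^+ 2)%R.
  have [G FG] := cell_set_homeo R n_gt0 L; exists (ball_map M f g), G.
  by split=> // z; exact: sqnorm_ball_map.
by rewrite E.
Qed.

(** A chain below [M] stays out of [F'(M)] only by having [M] as its top; hence every point lies in
    the open cell of the top of its chain and in no other. *)
Lemma cellFoP M z : cellFo R M z <-> supp z M /\ cellF R M z.
Proof.
split=> [[zM nzM]|[zM zF]].
  split=> //; apply: contrapT => nM; apply: nzM; apply/cellF'P => N zN.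
  have /cellFP/(_ _ zN) := zM; rewrite le_eqVlt => /predU1P[NM|//].
  by rewrite NM in zN.
by split=> // /cellF'P/(_ _ zM); rewrite ltxx.
Qed.

Lemma cellFo_unique M N z : cellFo R M z -> cellFo R N z -> M = N.
Proof.
move=> /cellFoP[zM /cellFP zFM] /cellFoP[zN /cellFP zFN].
by apply/eqP; rewrite eq_le zFN// zFM.
Qed.

Lemma exists_cellFo z : exists M, cellFo R M z.
Proof.
have [M zM Mmax] := supp_top z.
by exists M; apply/cellFoP; split=> //; apply/cellFP.
Qed.

Lemma vertex_cellFo M : exists2 z, cellFo R M z & forall N, supp z N -> N = M.
Proof.
have [z zM] := vertexP R M; exists z; last by move=> N /zM.
by apply/cellFoP; split; [exact/zM|apply/cellFP => N /zM ->].
Qed.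

Lemma cellFo_inj : injective (@cellFo R n).
Proof.
move=> M N E; have [z zM _] := vertex_cellFo M.
by apply: (cellFo_unique zM); rewrite -E.
Qed.

Lemma cellF'_bigcup M :
  cellF' R M = \bigcup_(N in [set N | (N < M)%O]) cellFo R N.
Proof.
apply/seteqP; split=> [z /cellF'P zM|z [N /= NM /cellFoP[zN /cellFP zFN]]].
  have [N zN] := exists_cellFo z; exists N => //=.
  by apply: zM; have /cellFoP[] := zN.
by apply/cellF'P => N' zN'; apply: le_lt_trans NM; exact: zFN.
Qed.

Lemma cellF'_sub M : cellF' R M `<=` cellF R M.
Proof. by move=> z /cellF'P zM; apply/cellFP => N /zM/ltW. Qed.

Lemma cellFo_set_homeo M F G :
  set_homeo (cellF R M) (unit_closed_ball R (cell_dim M)) F G ->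
  (forall z, cellF R M z -> sqnorm (F z) = depth M z ^+ 2)%R ->
  set_homeo (cellFo R M) (unit_open_ball R (cell_dim M)) F G /\
  set_homeo (cellF' R M) (unit_sphere R (cell_dim M)) F G.
Proof.
move=> FG sF.
have sph z : cellF R M z -> cellF' R M z <-> (sqnorm (F z) = 1)%R.
  move=> zM; rewrite -(depth_eq1 zM) sF//; split=> [->|/eqP];
    first by rewrite expr1n.
  by rewrite sqrp_eq1 ?depth_ge0// => /eqP.
split; apply: (set_homeoW FG).
- by move=> z [].
- by move=> u /ltW.
- move=> z zM; rewrite /unit_open_ball /= lt_neqAle.
  have -> /= : (sqnorm (F z) <= 1)%R by have [] := set_homeo_to FG zM.
  rewrite andbT; split=> [[_ nzM]|/eqP s1].
    by apply/eqP => /(sph z zM).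
  by split=> // /(sph z zM).
- exact: cellF'_sub.
- by move=> u; rewrite /unit_sphere /unit_closed_ball /= => ->.
- exact: sph.
Qed.

Lemma closure_cellFo (n_gt0 : (0 < n)%N) M : closure (cellFo R M) = cellF R M.
Proof.
apply/seteqP; split.
  have /closure_id -> : closed (cellF R M) by exact: closed_subrealization.
  by apply: closureS => z [].
move=> z zM; have [F [G [FG sF]]] := exists_cell_homeo n_gt0 M.
have [FGo _] := cellFo_set_homeo FG sF.
have [Fz GF] := set_homeo_to FG zM.
set B := unit_closed_ball R (cell_dim M) in FG Fz *.
have Gc := set_homeo_inv_cont FG.
move=> U; rewrite -GF => zU.
have : within B (nbhs (F z)) (G @^-1` U).
  by have := Gc (F z) U zU; rewrite /nbhs /= -nbhs_subspace_in.
rewrite /within /= => WU.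
(* Points of the sphere are approached radially from inside the ball, and the inverse homeomorphism
   carries this over to the cell. *)
have sc : ((1 - e) *: F z @[e --> (0:R)] --> ((1 - 0) *: F z))%R.
  apply: cvgZr_tmp; apply: cvgB; [exact: cvg_cst|exact: cvg_id].
rewrite subr0 scale1r in sc.
have /nbhs_ballP[e /= e0 eU] := sc _ WU.
pose t := (Num.min (e / 2) (1 / 2))%R.
have t0 : (0 < t)%R by rewrite lt_min !divr_gt0.
have t1 : (t < 1)%R by rewrite gt_min; apply/orP; right; lra.
have te : (t < e)%R by rewrite gt_min; apply/orP; left; lra.
have s1 : (sqnorm (F z) <= 1)%R := Fz.
have inB : unit_open_ball R (cell_dim M) ((1 - t) *: F z)%R.
  rewrite /unit_open_ball /= sqnormZ.
  have := sqnorm_ge0 (F z); have : ((1 - t) ^+ 2 < 1)%R by rewrite expr_lt1//;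
    lra.
  move=> lt ge0; apply: le_lt_trans lt.
  by rewrite -[leRHS]mulr1 ler_wpM2l// sqr_ge0.
exists (G ((1 - t) *: F z)%R); split.
  by have [] := set_homeo_of FGo inB.
apply: (eU t); last exact: ltW.
by rewrite /ball /= sub0r normrN gtr0_norm.
Qed.

End Stratification.

Theorem theorem3p2 (R : realType) (n : nat) (n_ge1 : (1 <= n)%N) :
  (forall (p q : nat) (M : CM n), nrows M = p -> ncols M = q ->
     closed_cell R (2 * n - (p + q)) (cellF R M) /\
     homeomorphic (cellF' R M) (unit_sphere R (2 * n - (p + q)))) /\
  (exists F : nat -> set (stochastihedron R n),
     regular_cell_decomposition R F
       (fun m => [set cellFo R M | M in
                  [set M : CM n | (2 * n - (nrows M + ncols M))%N = m]])) /\
  injective (@cellFo R n) /\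
  (forall M N : CM n,
     (M <= N)%O <-> closure (cellFo R M) `<=` closure (cellFo R N)).
Proof.
split; last split; last split.
- move=> p q M <- <-; have [F [G [FG sF]]] := exists_cell_homeo R n_ge1 M.
  have [_ FG'] := cellFo_set_homeo FG sF.
  split; first by have [h hh _] := set_homeo_homeomorphism FG; exists h.
  by have [h hh _] := set_homeo_homeomorphism FG'; exists h.
(* As [cell_dim] is monotone, membership in [F m] is decided by the top of the chain, so the strata
   consist of whole open cells. *)
- pose F m : set (stochastihedron R n) :=
    subrealization [set N | (cell_dim N <= m)%N].
  have stratumP m z : stratum F m z <-> exists2 M,
    cell_dim M = m & cellFo R M z.
    split=> [[/subrealizationP zm nz]|[M Mm /cellFoP[zM /cellFP zF]]].
      have [M zM] := exists_cellFo z; exists M => //.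
      have /cellFoP[MM /cellFP zF] := zM.
      apply/eqP; rewrite eqn_leq zm//=; case: m {zm} nz => // m nz.
      rewrite ltnNge; apply/negP => Mm; apply: nz;
        apply/subrealizationP => N zN /=.
      by apply: leq_trans Mm; exact/cell_dim_le/zF.
    split; first by apply/subrealizationP => N /zF NM;
      rewrite /= -Mm cell_dim_le.
    case: m Mm => [_ []|m Mm /subrealizationP zm].
    by have := zm _ zM; rewrite /= Mm ltnn.
  exists F; split; first split.
  + by move=> m; exact: closed_subrealization.
  + by move=> m z /subrealizationP zm; apply/subrealizationP => N /zm /= /leqW.
  + apply/seteqP; split=> // z _; exists (2 * n)%N => //.
    by apply/subrealizationP => N _; exact: leq_subr.
  + move=> m; apply/seteqP; split=> z.
      by move=> /stratumP[M Mm zM]; exists (cellFo R M) => //; exists M.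
    by move=> [_ [M Mm <-] zM]; apply/stratumP; exists M.
  + move=> m _ _ [M _ <-] [N _ <-] [z [zM zN]].
    by rewrite (cellFo_unique zM zN).
  + move=> m _ [M Mm <-]; rewrite -Mm.
    have [F' [G [FG sF]]] := exists_cell_homeo R n_ge1 M.
    have [FGo _] := cellFo_set_homeo FG sF.
    by have [h hh _] := set_homeo_homeomorphism FGo; exists h.
  (* The open star of the vertex [M] serves as [U]: in the stratum the top of the chain has
     dimension [m], and so equals [M] as soon as [M] is in the chain. *)
  + move=> m _ [M Mm <-]; exists (@supp R _ _ ^~ M).
      apply: (@open_comp _ _ (lin (fun b => (b == M)%:R)%R) [set x : R | (0 <
        x)%R]).
        by move=> z _; exact: continuous_lin.
      exact: open_gt.
    apply/seteqP; split=> z.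
      move=> zM; split; first by have /cellFoP[] := zM.
      by apply/stratumP; exists M.
    move=> [zM /stratumP[N Nm zN]]; have /cellFoP[_ /cellFP/(_ _ zM)] := zN.
    rewrite le_eqVlt => /predU1P[->//|/cell_dim_lt].
    by rewrite Nm (Mm : cell_dim M = m) ltnn.
  + move=> m _ [M Mm <-]; rewrite -Mm (closure_cellFo R n_ge1) -/(cell_dim M);
    split.
      have [F' [G [FG sF]]] := exists_cell_homeo R n_ge1 M.
      have [FGo FG'] := cellFo_set_homeo FG sF.
      have [h hh hG] := set_homeo_homeomorphism (set_homeo_sym FG).
      exists h => // x; rewrite hG.
      have [GM FGx] := set_homeo_of FG (set_valP x).
      split=> [xS [_ nS]|nS]; first by apply: nS;
        have [] := set_homeo_of FG' xS.
      have GS : cellF' R M (G (val x)) by apply: contrapT => nF; apply: nS.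
      by have [] := set_homeo_to FG' GS; rewrite FGx.
    exists [set cellFo R N | N in [set N | (N < M)%O]].
      by move=> _ [N _ <-]; exists (cell_dim N) => //; exists N.
    rewrite bigcup_image -cellF'_bigcup /cellFo setDD.
    by apply/setIidr; exact: cellF'_sub.
- exact: cellFo_inj.
- move=> M N; rewrite !(closure_cellFo R n_ge1); split=> [MN z /cellFP zM|MN].
    by apply/cellFP => N' /zM/le_trans; apply.
  (* The inclusion is tested on the vertex [M] alone. *)
  have [z /cellFoP[zM zF] _] := vertex_cellFo R M.
  by have /cellFP := MN _ zF; apply.
Qed.
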